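(* There is a bijection between minimal cones with (positive) definite induced metric in $\mathbb{R}^{p,q}$ and minimal submanifolds with (positive) definite induced metric of the quadric $Q=\{v\in\mathbb{R}^{p,q}\mid\langle v,v\rangle=1\}={\rm O}(p,q)/{\rm O}(p-1,q)$. The bijection sends a cone $i:\Sigma\times(0,\infty)\to\mathbb{R}^{p,q}$ to its restriction $i(\cdot,1):\Sigma\to Q$ to $r=1$.
   Context: $\mathbb{R}^{p,q}$ is $\mathbb{R}^{p+q}$ with an inner product $\langle\,,\,\rangle$ of signature $(p,q)$. A submanifold $X$ of $\mathbb{R}^{p,q}$ is a cone if $X$ is diffeomorphic to $\Sigma\times(0,\infty)$ in such a way that the inclusion $i:X\to\mathbb{R}^{p,q}$ satisfies $i(x,r)=r\,i(x,1)$ and the induced metric on $X$ has the form $dr^2+r^2g_\Sigma$ with $g_\Sigma$ independent of $r$. A submanifold with non-degenerate induced metric is minimal if its inclusion is harmonic with respect to the induced metric. *)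

(* Defs.v *)
From HB Require Import structures.
From mathcomp Require Import all_boot all_order all_algebra.
From mathcomp Require Import all_classical all_reals all_analysis.

Set Implicit Arguments.
Unset Strict Implicit.
Unset Printing Implicit Defensive.

Import Order.TTheory GRing.Theory Num.Theory.
Import numFieldNormedType.Exports.

Local Open Scope classical_set_scope.
Local Open Scope ring_scope.

Section smooth.
Context {R : realType} {V W : normedModType R}.
Implicit Types (A : set V) (B : set W) (f : V -> W).

Definition iterated_derive (s : seq V) f : V -> W :=
  foldr (fun v g x => 'D_v g x) f s.

(* [Cinfty] is meant for open [U] and finite-dimensional [V]: all iterated
   directional derivatives are differentiable, hence continuous. *)
Definition Cinfty (U : set V) f : Prop :=
  forall (s : seq V) x, U x -> differentiable (iterated_derive s f) x.

(* Smoothness on an arbitrary subset: local existence of smooth extensions. *)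
Definition smooth_on A f : Prop :=
  forall x, A x -> exists (U : set V) (F : V -> W),
    [/\ open U, U x, Cinfty U F & forall y, U y -> A y -> F y = f y].

End smooth.

Definition diffeomorphism {R : realType} {V W : normedModType R}
    (A : set V) (B : set W) (f : V -> W) : Prop :=
  [/\ f @` A = B, smooth_on A f &
    exists g : W -> V, (forall x, A x -> g (f x) = x) /\ smooth_on B g].

Section submanifold.
Context {R : realType} {n : nat}.
Implicit Types M : set 'rV[R]_n.

Definition local_parametrization M k (U : set 'rV[R]_k)
    (phi : 'rV[R]_k -> 'rV[R]_n) : Prop :=
  [/\ open U, diffeomorphism U (phi @` U) phi &
    exists W : set 'rV[R]_n, open W /\ phi @` U = M `&` W].

Definition submanifold_dim k M : Prop :=
  forall x, M x -> exists (U : set 'rV[R]_k) (phi : 'rV[R]_k -> 'rV[R]_n),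
    local_parametrization M U phi /\ (phi @` U) x.

Definition submanifold M : Prop := exists k, submanifold_dim k M.

End submanifold.

Section coordinates.
Context {R : realType}.

Definition partial k (a : 'I_k) (f : 'rV[R]_k -> R) : 'rV[R]_k -> R :=
  fun u => 'D_(delta_mx 0 a) (f : _ -> R^o) u.

(* [christoffel g c a b] is Gamma^c_{ab}, the Christoffel symbol of the
   Levi-Civita connection of the metric [g]. *)
Definition christoffel k (g : 'rV[R]_k -> 'M[R]_k) (c a b : 'I_k)
    (u : 'rV[R]_k) : R :=
  2^-1 * \sum_d invmx (g u) c d *
    (partial a (fun w => g w b d) u + partial b (fun w => g w a d) u
     - partial d (fun w => g w a b) u).

(* The components of the trace with respect to [g] of the second fundamental
   form of a map [F] from (R^k, g) to (R^l, h). *)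
Definition tension k l (g : 'rV[R]_k -> 'M[R]_k) (h : 'rV[R]_l -> 'M[R]_l)
    (F : 'rV[R]_k -> 'rV[R]_l) (e : 'I_l) (u : 'rV[R]_k) : R :=
  let F_ (i : 'I_l) := fun w => F w 0 i in
  \sum_a \sum_b invmx (g u) a b *
    (partial a (partial b (F_ e)) u
     - \sum_c christoffel g c a b u * partial c (F_ e) u
     + \sum_i \sum_j christoffel h e i j (F u)
                     * partial a (F_ i) u * partial b (F_ j) u).

End coordinates.

Section pseudo_euclidean.
Context {R : realType}.

Definition ip n (B : 'M[R]_n) (v w : 'rV[R]_n) : R := (v *m B *m w^T) 0 0.

Definition std_form p q : 'M[R]_(p + q) := block_mx 1%:M 0 0 (- 1%:M).

(* The rows of [P] form an orthonormal basis consisting of [p] vectors of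
   square 1 followed by [q] vectors of square -1. *)
Definition has_signature p q (B : 'M[R]_(p + q)) : Prop :=
  exists2 P : 'M[R]_(p + q), P \in unitmx & P *m B *m P^T = std_form p q.

Definition quadric n (B : 'M[R]_n) : set 'rV[R]_n := [set v | ip B v v = 1].

(* Linear isometries, acting on row vectors on the right. *)
Definition isometries n (B : 'M[R]_n) : set 'M[R]_n :=
  [set A | A *m B *m A^T = B].

Definition stabilizer n (B : 'M[R]_n) (v : 'rV[R]_n) : set 'M[R]_n :=
  isometries B `&` [set A | v *m A = v].

(* Q = O(p,q) / O(p-1,q); when [p = 0] the quadric is empty. *)
Definition quadric_is_homogeneous p q (B : 'M[R]_(p + q)) : Prop :=
  forall v, quadric B v ->
    [set v *m A | A in isometries B] = quadric B /\
    exists h : 'M[R]_(p + q) -> 'M[R]_(p.-1 + q),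
      set_bij (stabilizer B v) (isometries (std_form p.-1 q)) h /\
      forall A C, stabilizer B v A -> stabilizer B v C ->
        h (A *m C) = h A *m h C.

Section induced_metric.
Context {n : nat} (B : 'M[R]_n).
Implicit Types M N : set 'rV[R]_n.

Definition induced_metric k (phi : 'rV[R]_k -> 'rV[R]_n) (u : 'rV[R]_k) :
    'M[R]_k :=
  \matrix_(a, b) ip B ('D_(delta_mx 0 a) phi u) ('D_(delta_mx 0 b) phi u).

Definition nondegenerate_metric M : Prop :=
  forall k (U : set 'rV[R]_k) (phi : 'rV[R]_k -> 'rV[R]_n),
    local_parametrization M U phi ->
    forall u, U u -> induced_metric phi u \in unitmx.

Definition positive_definite_metric M : Prop :=
  forall k (U : set 'rV[R]_k) (phi : 'rV[R]_k -> 'rV[R]_n),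
    local_parametrization M U phi ->
    forall u v, U u -> v != 0 -> 0 < ip (induced_metric phi u) v v.

(* [M] and [N] carry the metrics induced by [B]; [F] is the expression of [f]
   in the coordinates given by [phi] and [chi]. *)
Definition harmonic M N (f : 'rV[R]_n -> 'rV[R]_n) : Prop :=
  [/\ smooth_on M f, f @` M `<=` N &
    forall k l (U : set 'rV[R]_k) (phi : 'rV[R]_k -> 'rV[R]_n)
      (V : set 'rV[R]_l) (chi : 'rV[R]_l -> 'rV[R]_n)
      (F : 'rV[R]_k -> 'rV[R]_l),
      local_parametrization M U phi -> local_parametrization N V chi ->
      (forall u, U u -> V (F u) /\ chi (F u) = f (phi u)) ->
      forall u e, U u ->
        tension (induced_metric phi) (induced_metric chi) F e u = 0].

Definition minimal_in N M : Prop :=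
  [/\ submanifold M, M `<=` N, nondegenerate_metric M & harmonic M N id].

(* [i : Sigma x (0, oo) -> X] exhibits [X] as a cone. The abstract manifold
   [Sigma] is realized as a submanifold of some Euclidean space R^m. The last
   clause says that the pulled back metric is dr^2 + r^2 gS; only the values of
   [gS x] on tangent vectors to [Sigma] at [x] matter, and there the clause
   (with r = 1) forces [gS] to be a smooth symmetric bilinear tensor. *)
Definition cone_presentation (X : set 'rV[R]_n) m (Sigma : set 'rV[R]_m)
    (i : 'rV[R]_m * R^o -> 'rV[R]_n) : Prop :=
  [/\ submanifold Sigma,
      diffeomorphism (Sigma `*` [set r : R^o | 0 < r]) X i,
      (forall x (r : R), Sigma x -> 0 < r -> i (x, r) = r *: i (x, 1)) &
      exists gS : 'rV[R]_m -> 'rV[R]_m -> 'rV[R]_m -> R,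
      forall k (U : set 'rV[R]_k) (phi : 'rV[R]_k -> 'rV[R]_m),
        local_parametrization Sigma U phi ->
        let psi (z : 'rV[R]_k * R^o) := i (phi z.1, z.2) in
        forall u (r : R), U u -> 0 < r ->
        forall (v w : 'rV[R]_k) (s t : R),
          ip B ('D_((v, s) : 'rV[R]_k * R^o) psi (u, r))
               ('D_((w, t) : 'rV[R]_k * R^o) psi (u, r))
          = s * t + r ^+ 2 * gS (phi u) ('D_v phi u) ('D_w phi u)].

Definition cone (X : set 'rV[R]_n) : Prop :=
  submanifold X /\
  exists m (Sigma : set 'rV[R]_m) (i : 'rV[R]_m * R^o -> 'rV[R]_n),
    cone_presentation X Sigma i.

Definition minimal_cones : set (set 'rV[R]_n) :=
  [set X | [/\ cone X, positive_definite_metric X & minimal_in setT X]].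

Definition minimal_submanifolds_of_quadric : set (set 'rV[R]_n) :=
  [set S | positive_definite_metric S /\ minimal_in (quadric B) S].

End induced_metric.
End pseudo_euclidean.

(* Main.v *)
(* Write [trace_hess phi] for the trace, with respect to the metric induced by
   [phi], of the second derivative of a parametrization [phi] of [M]. By the
   Koszul formula its component normal to [M] is the mean curvature vector, and
   the identity of [M] is harmonic into [N] (N = R^{p,q} or N = Q) exactly when
   [trace_hess phi] is orthogonal to every vector that is tangent to [N] and
   normal to [M]. At a point r s of the cone over S, the tangent space is the
   sum of the line through s and of T_s S, the radial second derivatives are
   tangent, and the trace of the remaining ones is r^-1 times the trace for S.
   Hence the normal vectors to be tested for the cone in R^{p,q} and for S in Q
   are the same, and so are the two conditions. Transitivity of O(p,q) on Q is
   obtained from reflections. *)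
From HB Require Import structures.
Require Import Defs.
From mathcomp Require Import all_boot all_order all_algebra.
From mathcomp Require Import all_classical all_reals all_analysis.
From mathcomp Require Import ring.
Import Order.TTheory GRing.Theory Num.Theory.
Import numFieldNormedType.Exports.
Local Open Scope classical_set_scope.
Local Open Scope ring_scope.

Set Implicit Arguments.
Unset Strict Implicit.
Unset Printing Implicit Defensive.

(** * Smoothness by finite order *)

(** Metrics and harmonicity are quantified over all local parametrizations, while the cone can only
    be computed in polar charts [cone_param]. Facts are therefore moved between charts by factoring
    one parametrization through another; [trace_hess] is not invariant under this, only its pairing
    with normal vectors is. Two charts are not known beforehand to have equal dimension, so changes
    of basis are rectangular matrices with two-sided inverses. Harmonicity into Q says nothing until
    Q has charts: these are built as graphs over the orthogonal complement of a point, and the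
    tangent space is identified with that complement through the radial retraction instead of a
    dimension count. Evaluating dr^2 + r^2 g on the radial vector puts the slice r = 1 of any
    presentation inside Q. The restriction thus becomes intersection with Q, which mentions no
    presentation, and its inverse sends S to the set of its positive multiples. *)

(** The difference [g - f] vanishes near [x], so it has differential 0 there; adding it to [f] gives
    [g]. *)
Lemma near_eq_differentiable (R : realType) (V W : normedModType R)
    (f g : V -> W) (x : V) :
  (\forall y \near x, f y = g y) -> differentiable f x -> differentiable g x.
Proof.
move=> fg df; rewrite (_ : g = f + (g - f)); last first.
  by apply/funext => y; rewrite !fctE addrC subrK.
apply: differentiableD => //.
have h0 : \forall y \near x, (g - f) y = 0.
  by near=> y; rewrite !fctE (near fg y) ?subrr.
have h0' : \forall z \near 0, (g - f) (z + x) = 0.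
  by move: h0; rewrite (near_shift 0 x) subr0.
have hx : (g - f) x = 0 by exact: nbhs_singleton h0.
have e0 : (g - f) \o shift x = cst ((g - f) x) + 0 +o_ (0 : V) id.
  apply/eqaddoP => _/posnumP[e]; near=> y.
  have E : (g - f) (y + x) = 0 by exact: (near h0' y).
  change (`|(g - f) (y + x) - ((g - f) x + 0)| <= e%:num * `|y|).
  by rewrite E hx addr0 subrr normr0 mulr_ge0.
apply/diff_locallyP.
have c0 : continuous (0 : V -> W) by exact: cst_continuous.
have -> : 'd (g - f) x = 0 :> (V -> W) by apply/diff_unique.
by split.
Unshelve. all: by end_near. Qed.

Section scale.
Context {R : realType} {V W : normedModType R}.

(** Scaling is packaged as a bilinear map so that the product rule becomes an instance of the
    differential of a bilinear map. *)
Definition scal (k : R^o) (w : W) : W := k *: w.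

Lemma scal_is_bilinear :
  bilinear_for
    (GRing.Scale.Law.clone _ _ *:%R _) (GRing.Scale.Law.clone _ _ *:%R _) scal.
Proof.
split=> [w|k] a x y /=; rewrite /scal.
- by rewrite scalerDl scalerA.
- by rewrite scalerDr !scalerA mulrC.
Qed.

HB.instance Definition _ :=
  bilinear_isBilinear.Build R R^o W W _ _ scal scal_is_bilinear.

Lemma derive_scale (k : V -> R^o) (f : V -> W) (x v : V) :
  differentiable k x -> differentiable f x ->
  differentiable (fun y => k y *: f y) x /\
  'D_v (fun y => k y *: f y) x = k x *: 'D_v f x + 'D_v k x *: f x.
Proof.
move=> dk df.
have dp := differentiable_pair dk df.
have cs : continuous (fun p : R^o * W => scal p.1 p.2) by exact: scale_continuous.
have ds : differentiable (fun p : R^o * W => scal p.1 p.2) (k x, f x).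
  exact: differentiable_bilin.
have E : (fun y => k y *: f y) =
    (fun p : R^o * W => scal p.1 p.2) \o (fun y => (k y, f y)) by [].
rewrite E; split; first exact: differentiable_comp.
rewrite !deriveE //; last exact: differentiable_comp.
by rewrite diff_comp // diff_bilin // diff_pair.
Qed.

End scale.

(** Derivatives of products and composites are sums of such terms, so the list of directions in
    [Cinfty] is awkward to induct on. Here the induction is on the order, for all functions and
    directions at once; [Cn k] asks for [k.+1] successive derivatives. *)
Fixpoint Cn {R : realType} {V W : normedModType R} (k : nat) (U : set V)
    (f : V -> W) : Prop :=
  (forall x, U x -> differentiable f x) /\
  (if k is k'.+1 then forall v, Cn k' U (fun x => 'D_v f x) else True).

Section Cn_basic.
Context {R : realType} {V W : normedModType R}.
Implicit Types (U : set V) (f g : V -> W).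

Lemma Cn_differentiable k U f x : Cn k U f -> U x -> differentiable f x.
Proof. by case: k => [|k] [df _]; exact: df. Qed.

Lemma Cn_derive k U f v : Cn k.+1 U f -> Cn k U (fun x => 'D_v f x).
Proof. by case=> _; apply. Qed.

Lemma CnW k U f : Cn k.+1 U f -> Cn k U f.
Proof.
elim: k f => [|k IH] f [df d2f]; first by [].
by split=> // v; apply: IH.
Qed.

Lemma eq_Cn k U f g : open U -> (forall x, U x -> f x = g x) ->
  Cn k U f -> Cn k U g.
Proof.
move=> oU fgU.
have fg f1 g1 : (forall x, U x -> f1 x = g1 x) ->
    forall x, U x -> \forall y \near x, f1 y = g1 y.
  by move=> E x Ux; apply: filterS (open_nbhs_nbhs (conj oU Ux)).
elim: k f g fgU => [|k IH] f g fgU [df d2f]; split=> //.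
- by move=> x Ux; apply: near_eq_differentiable (df x Ux); exact: fg.
- by move=> x Ux; apply: near_eq_differentiable (df x Ux); exact: fg.
- by move=> v; apply: IH (d2f v) => x Ux; apply: near_eq_derive; exact: fg.
Qed.

Lemma CinftyP U f : Cinfty U f <-> forall k, Cn k U f.
Proof.
split=> [Cf k|Cf s].
  elim: k f Cf => [|k IH] f Cf; split=> //.
  - by move=> x; exact: (Cf [::]).
  - by move=> x; exact: (Cf [::]).
  - move=> v; apply: IH => s x Ux.
    (* [foldr] applies the last direction of the list first, so differentiating [f] beforehand
       appends to the list. *)
    by have := Cf (rcons s v) x Ux; rewrite /iterated_derive foldr_rcons.
elim/last_ind: s f Cf => [|s v IH] f Cf x Ux.
  exact: Cn_differentiable (Cf 0%N) Ux.
rewrite /iterated_derive foldr_rcons; apply: (IH _ _ x Ux) => k.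
exact: Cn_derive (Cf k.+1).
Qed.

Lemma Cinfty_differentiable U f x : Cinfty U f -> U x -> differentiable f x.
Proof. by move=> Cf; exact: (Cf [::]). Qed.

Lemma Cinfty_derive U f v : Cinfty U f -> Cinfty U (fun x => 'D_v f x).
Proof. by move=> /CinftyP Cf; apply/CinftyP => k; exact: Cn_derive (Cf k.+1). Qed.

Lemma Cinfty_sub U U' f : U' `<=` U -> Cinfty U f -> Cinfty U' f.
Proof. by move=> sU Cf s x /sU; exact: Cf. Qed.

Lemma eq_Cinfty U f g : open U -> (forall x, U x -> f x = g x) ->
  Cinfty U f -> Cinfty U g.
Proof.
by move=> oU fg /CinftyP Cf; apply/CinftyP => k; apply: eq_Cn fg (Cf k).
Qed.

Lemma Cinfty_locally U f :
  (forall x, U x -> exists2 U', open U' /\ U' x & Cinfty U' f) -> Cinfty U f.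
Proof. by move=> lf s x /lf[U' [_ U'x]]; apply. Qed.

Lemma Cn0 U f : (forall x, U x -> differentiable f x) -> Cn 0 U f.
Proof. by []. Qed.

Lemma CnS k U f : open U -> (forall x, U x -> differentiable f x) ->
  (forall v, exists2 g, Cn k U g & forall x, U x -> g x = 'D_v f x) ->
  Cn k.+1 U f.
Proof. by move=> oU df dvf; split=> // v; have [g Cg /eq_Cn] := dvf v; apply. Qed.

Lemma Cn_cst k U (a : W) : Cn k U (fun=> a).
Proof.
elim: k a => [|k IH] a; split=> //; try by move=> x _; exact: differentiable_cst.
move=> v; have -> : (fun x => 'D_v (fun=> a) x) = fun=> 0.
  by apply/funext => x; rewrite -[fun=> a]/(cst a) derive_cst.
exact: IH.
Qed.

Lemma Cn_add k U f g : open U -> Cn k U f -> Cn k U g ->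
  Cn k U (fun x => f x + g x).
Proof.
move=> oU; elim: k f g => [|k IH] f g Cf Cg; have df := Cn_differentiable Cf;
  have dg := Cn_differentiable Cg.
  by apply: Cn0 => x Ux; apply: differentiableD; [exact: df|exact: dg].
apply: CnS => // [x Ux|v]; first by apply: differentiableD; [exact: df|exact: dg].
exists (fun x => 'D_v f x + 'D_v g x).
  by apply: IH; exact: Cn_derive.
by move=> x Ux; rewrite -deriveD //; apply: diff_derivable; [exact: df|exact: dg].
Qed.

End Cn_basic.

Section Cn_scale.
Context {R : realType} {V W : normedModType R}.
Implicit Types (U : set V) (f g : V -> W).

Lemma Cn_scale k U (c : V -> R^o) f : open U -> Cn k U c -> Cn k U f ->
  Cn k U (fun x => c x *: f x).
Proof.
move=> oU; elim: k c f => [|k IH] c f Cc Cf; have df := Cn_differentiable Cf;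
  have dc := Cn_differentiable Cc.
  by apply: Cn0 => x Ux; have [] := derive_scale 0 (dc _ Ux) (df _ Ux).
apply: CnS => // [x Ux|v].
  by have [] := derive_scale 0 (dc _ Ux) (df _ Ux).
exists (fun x => c x *: 'D_v f x + 'D_v c x *: f x).
  apply: Cn_add => //; apply: IH.
  - exact: CnW.
  - exact: Cn_derive.
  - exact: Cn_derive.
  - exact: CnW.
by move=> x Ux; have [_ ->] := derive_scale v (dc _ Ux) (df _ Ux).
Qed.

Lemma Cn_sum k U I (r : seq I) (P : pred I) (F : I -> V -> W) : open U ->
  (forall i, Cn k U (F i)) -> Cn k U (fun x => \sum_(i <- r | P i) F i x).
Proof.
move=> oU CF; elim: r => [|i r IH].
  by apply: eq_Cn (Cn_cst k U (0:W)) => // x _; rewrite big_nil.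
case: (boolP (P i)) => Pi.
  by apply: eq_Cn (Cn_add oU (CF i) IH) => // x _; rewrite big_cons Pi.
by apply: eq_Cn IH => // x _; rewrite big_cons (negbTE Pi).
Qed.

End Cn_scale.

Lemma Cn_linear {R : realType} {V W X : normedModType R} k (U : set V)
    (L : {linear W -> X}) (f : V -> W) : open U -> continuous L ->
  Cn k U f -> Cn k U (fun x => L (f x)).
Proof.
move=> oU cL; have dL w : differentiable L w by exact: linear_differentiable.
elim: k f => [|k IH] f Cf; have df := Cn_differentiable Cf.
  by apply: Cn0 => x Ux; apply: (differentiable_comp (df x Ux)).
apply: CnS => // [x Ux|v]; first exact: (differentiable_comp (df x Ux)).
exists (fun x => L ('D_v f x)); first by apply: IH; exact: Cn_derive.
move=> x Ux; rewrite (deriveE _ (df x Ux)) deriveE; last first.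
  exact: (differentiable_comp (df x Ux)).
by rewrite (diff_comp (df x Ux)) //= diff_lin.
Qed.

Lemma Cn_of_linear {R : realType} {V W : normedModType R} k (U : set V)
    (L : {linear V -> W}) : continuous L -> Cn k U L.
Proof.
move=> cL; have dL w : differentiable L w by exact: linear_differentiable.
case: k => [|k]; split=> // v.
have -> : (fun x => 'D_v L x) = fun=> L v; last exact: Cn_cst.
by apply/funext => x; rewrite deriveE // diff_lin.
Qed.

Lemma Cn_id {R : realType} {V : normedModType R} k (U : set V) : Cn k U id.
Proof. by apply: (@Cn_of_linear R V V k U idfun) => ? //. Qed.

(** Finite dimension, in a form that passes to products such as R^m x R and supplies continuous
    coordinates for the chain rule. *)
Definition has_coordinates {R : realType} (W : normedModType R) : Prop :=
  exists N (e : 'I_N -> W) (c : 'I_N -> {linear W -> R^o}),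
    (forall i, continuous (c i)) /\ forall w, w = \sum_i c i w *: e i.

(** The composite is differentiated along ['D_v g x], a direction for [f] that moves with [x].
    Expanding it in coordinates leaves a finite sum of products involving only the fixed directions
    [e i], to which the induction hypothesis applies. *)
Lemma Cn_comp {R : realType} {V W X : normedModType R} k (U : set V)
    (U' : set W) (g : V -> W) (f : W -> X) : has_coordinates W ->
  open U -> (forall x, U x -> U' (g x)) ->
  Cn k U g -> Cn k U' f -> Cn k U (fun x => f (g x)).
Proof.
move=> [N [e [c [cc ec]]]] oU gU.
elim: k f => [|k IH] f Cg Cf; have dg := Cn_differentiable Cg;
  have df := Cn_differentiable Cf.
  by apply: Cn0 => x Ux; apply: (differentiable_comp (dg x Ux)); apply: df; exact: gU.
have dgf x : U x -> differentiable (f \o g) x.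
  by move=> Ux; apply: (differentiable_comp (dg x Ux)); apply: df; exact: gU.
apply: CnS => // v.
exists (fun x => \sum_i c i ('D_v g x) *: 'D_(e i) f (g x)).
  apply: Cn_sum => // i; apply: Cn_scale => //.
    by apply: Cn_linear => //; exact: Cn_derive.
  by apply: (IH (fun y => 'D_(e i) f y)); [exact: CnW|exact: Cn_derive].
move=> x Ux; rewrite (deriveE _ (dgf x Ux)) (diff_comp (dg x Ux) (df _ (gU _ Ux))) /=.
rewrite -(deriveE _ (dg x Ux)) [in RHS](ec ('D_v g x)) linear_sum.
by apply: eq_bigr => i _; rewrite linearZ (deriveE _ (df _ (gU _ Ux))).
Qed.

Section Cn_real.
Context {R : realType} {V : normedModType R}.
Implicit Types (U : set V) (f g : V -> R^o).

Lemma Cn_mul k U f g : open U -> Cn k U f -> Cn k U g ->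
  Cn k U (fun x => f x * g x : R^o).
Proof. by move=> oU Cf Cg; exact: (Cn_scale oU Cf Cg). Qed.

Lemma derive_inv f x v : differentiable f x -> f x != 0 ->
  differentiable (fun y => (f y)^-1 : R^o) x /\
  'D_v (fun y => (f y)^-1 : R^o) x = - ((f x)^-1 * (f x)^-1) * 'D_v f x.
Proof.
move=> df fx0; split; first exact: (differentiableV df fx0).
have -> := deriveV fx0 (diff_derivable df).
by rewrite /GRing.scale /= -exprVn expr2.
Qed.

Lemma Cn_inv k U f : open U -> (forall x, U x -> f x != 0) -> Cn k U f ->
  Cn k U (fun x => (f x)^-1 : R^o).
Proof.
move=> oU f0; elim: k => [|k IH] Cf; have df := Cn_differentiable Cf.
  by apply: Cn0 => x Ux; have [] := derive_inv 0 (df x Ux) (f0 x Ux).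
apply: CnS => // [x Ux|v]; first by have [] := derive_inv 0 (df x Ux) (f0 x Ux).
exists (fun x => (-1) * ((f x)^-1 * (f x)^-1) * 'D_v f x).
  have Ci := IH (CnW Cf).
  apply: Cn_mul => //; last exact: Cn_derive.
  by apply: Cn_mul => //; [exact: Cn_cst|exact: Cn_mul].
by move=> x Ux; have [_ ->] := derive_inv v (df x Ux) (f0 x Ux); rewrite mulN1r.
Qed.

Lemma derive_sqrt_comp f x v : differentiable f x -> 0 < f x ->
  differentiable (fun y => Num.sqrt (f y) : R^o) x /\
  'D_v (fun y => Num.sqrt (f y) : R^o) x = (2 * Num.sqrt (f x))^-1 * 'D_v f x.
Proof.
move=> df fx0.
have isd := is_derive1_sqrt fx0.
have ds : differentiable (@Num.sqrt R : R^o -> R^o) (f x).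
  by apply/derivable1_diffP; have [] := isd.
have dsf : differentiable ((@Num.sqrt R : R^o -> R^o) \o f) x.
  exact: differentiable_comp.
split=> //; rewrite (deriveE _ dsf) (diff_comp df ds) /= -(deriveE _ df).
have -> : 'D_v f x = 'D_v f x *: (1 : R^o) by rewrite /GRing.scale /= mulr1.
by rewrite linearZ -deriveE //= (@derive_val _ _ _ _ _ _ _ isd) /GRing.scale /= mulr1 mulrC.
Qed.

Lemma Cn_sqrt k U f : open U -> (forall x, U x -> 0 < f x) -> Cn k U f ->
  Cn k U (fun x => Num.sqrt (f x) : R^o).
Proof.
move=> oU f0; elim: k => [|k IH] Cf; have df := Cn_differentiable Cf.
  by apply: Cn0 => x Ux; have [] := derive_sqrt_comp 0 (df x Ux) (f0 x Ux).
apply: CnS => // [x Ux|v]; first by have [] := derive_sqrt_comp 0 (df x Ux) (f0 x Ux).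
exists (fun x => (2 * Num.sqrt (f x))^-1 * 'D_v f x).
  have Ci := IH (CnW Cf).
  apply: Cn_mul => //; last exact: Cn_derive.
  apply: Cn_inv => // [x Ux|].
    by rewrite mulf_neq0 // gt_eqF // sqrtr_gt0 f0.
  by apply: Cn_mul => //; exact: Cn_cst.
by move=> x Ux; have [_ ->] := derive_sqrt_comp v (df x Ux) (f0 x Ux).
Qed.

End Cn_real.

(** * Smooth maps between coordinate spaces, symmetry of second derivatives *)

Section coordinates.
Context {R : realType}.

Definition rV_coord m (i : 'I_m) (w : 'rV[R]_m) : R^o := w 0 i.

Lemma rV_coord_is_linear m (i : 'I_m) : linear (rV_coord i).
Proof. by move=> a x y; rewrite /rV_coord !mxE. Qed.

HB.instance Definition _ m (i : 'I_m) :=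
  GRing.isLinear.Build R 'rV[R]_m R^o _ (rV_coord i) (rV_coord_is_linear i).

Lemma has_coordinates_rV m : has_coordinates 'rV[R]_m.
Proof.
exists m, (delta_mx 0), (fun i => rV_coord i); split.
  by move=> i; exact: coord_continuous.
by move=> w; rewrite {1}(row_sum_delta w).
Qed.

Lemma has_coordinates_R : has_coordinates R^o.
Proof.
exists 1%N, (fun=> 1), (fun=> idfun); split=> [i x //|w].
by rewrite big_ord1 /GRing.scale /= mulr1.
Qed.

Lemma has_coordinates_prod (V W : normedModType R) :
  has_coordinates V -> has_coordinates W -> has_coordinates (V * W)%type.
Proof.
move=> [N1 [e1 [c1 [cc1 ec1]]]] [N2 [e2 [c2 [cc2 ec2]]]].
exists (N1 + N2)%N, (fun i => match fintype.split i with
  inl j => (e1 j, 0) | inr j => (0, e2 j) end).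
exists (fun i => match fintype.split i with
  | inl j => (c1 j \o fst : {linear (V * W)%type -> R^o})
  | inr j => (c2 j \o snd : {linear (V * W)%type -> R^o}) end).
split=> [i|[v w]].
  case: (fintype.split i) => j x /=.
    by apply: continuous_comp; [exact: cvg_fst|exact: cc1].
  by apply: continuous_comp; [exact: cvg_snd|exact: cc2].
rewrite big_split_ord /=.
under eq_bigr do rewrite (unsplitK (inl _)) /=.
under [X in _ + X]eq_bigr do rewrite (unsplitK (inr _)) /=.
have E1 : \sum_(i < N1) c1 i v *: ((e1 i, 0) : (V * W)%type) = (v, 0).
  rewrite {2}(ec1 v); elim/big_ind2: _ => // [x1 y1 x2 y2 -> ->|i _].
    by apply: injective_projections => //=; rewrite addr0.
  by apply: injective_projections => //=; rewrite scaler0.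
have E2 : \sum_(i < N2) c2 i w *: ((0, e2 i) : (V * W)%type) = (0, w).
  rewrite {2}(ec2 w); elim/big_ind2: _ => // [x1 y1 x2 y2 -> ->|i _].
    by apply: injective_projections => //=; rewrite addr0.
  by apply: injective_projections => //=; rewrite scaler0.
by rewrite E1 E2; apply: injective_projections => /=; rewrite ?addr0 ?add0r.
Qed.

Lemma coordinates_linear_continuous (V W : normedModType R)
    (f : {linear V -> W}) : has_coordinates V -> continuous f.
Proof.
move=> [N [e [c [cc ec]]]].
have -> : (f : V -> W) = fun w => \sum_i c i w *: f (e i).
  by apply/funext => w; rewrite {1}(ec w) linear_sum; apply: eq_bigr => i _; rewrite linearZ.
move=> x; apply: cvg_big => [|i _]; first exact: add_continuous.
by apply: cvgZr_tmp; exact: cc.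
Qed.

End coordinates.


Section Cinfty_closure.
Context {R : realType} {V W X : normedModType R}.
Implicit Types (U : set V) (f g : V -> W) (c d : V -> R^o).

Lemma Cinfty_cst U (a : W) : Cinfty U (fun=> a).
Proof. by apply/CinftyP => k; exact: Cn_cst. Qed.

Lemma Cinfty_add U f g : open U -> Cinfty U f -> Cinfty U g ->
  Cinfty U (fun x => f x + g x).
Proof. by move=> oU /CinftyP Cf /CinftyP Cg; apply/CinftyP => k; apply: Cn_add. Qed.

Lemma Cinfty_scale U c f : open U -> Cinfty U c -> Cinfty U f ->
  Cinfty U (fun x => c x *: f x).
Proof. by move=> oU /CinftyP Cf /CinftyP Cg; apply/CinftyP => k; apply: Cn_scale. Qed.

Lemma Cinfty_inv U c : open U -> (forall x, U x -> c x != 0) -> Cinfty U c ->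
  Cinfty U (fun x => (c x)^-1 : R^o).
Proof. by move=> oU c0 /CinftyP Cf; apply/CinftyP => k; apply: Cn_inv. Qed.

Lemma Cinfty_sqrt U c : open U -> (forall x, U x -> 0 < c x) -> Cinfty U c ->
  Cinfty U (fun x => Num.sqrt (c x) : R^o).
Proof. by move=> oU c0 /CinftyP Cf; apply/CinftyP => k; apply: Cn_sqrt. Qed.

Lemma Cinfty_comp U (U' : set W) g (f : W -> X) : has_coordinates W ->
  open U -> (forall x, U x -> U' (g x)) ->
  Cinfty U g -> Cinfty U' f -> Cinfty U (fun x => f (g x)).
Proof.
by move=> cW oU gU /CinftyP Cg /CinftyP Cf; apply/CinftyP => k; apply: Cn_comp (Cg k) (Cf k).
Qed.

Lemma Cinfty_linear U f : has_coordinates V -> linear f -> Cinfty U f.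
Proof.
move=> cV lf.
pose fM := GRing.isLinear.Build _ _ _ _ f lf.
pose fL : {linear V -> W} := HB.pack f fM.
apply/CinftyP => k; rewrite -[f]/(fL : V -> W); apply: Cn_of_linear.
exact: coordinates_linear_continuous.
Qed.

Lemma derive_linear f x v : has_coordinates V -> linear f -> 'D_v f x = f v.
Proof.
move=> cV lf.
pose fM := GRing.isLinear.Build _ _ _ _ f lf.
pose fL : {linear V -> W} := HB.pack f fM.
have cf : continuous fL by exact: coordinates_linear_continuous.
have df : differentiable fL x by exact: linear_differentiable.
by rewrite -[f]/(fL : V -> W) deriveE // diff_lin.
Qed.

End Cinfty_closure.

Section Schwarz.
Context {R : realType} {V : normedModType R}.
Implicit Types (f : V -> R^o).

Lemma MVT_line f (x a : V) (s : R) : 0 < s ->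
  (forall t, 0 <= t <= s -> differentiable f (x + t *: a)) ->
  exists2 t, 0 < t < s & f (x + s *: a) - f x = s * 'D_a f (x + t *: a).
Proof.
move=> s0 df.
pose g (t : R) : R := f (x + t *: a).
have gE t : (fun h : R => h^-1 *: (g (h *: 1 + t) - g t)) =
    (fun h => h^-1 *: (f (h *: a + (x + t *: a)) - f (x + t *: a))).
  apply/funext => h; rewrite /g; congr (_ *: (f _ - _)).
  by rewrite [h *: 1]mulr1 scalerDl addrCA.
have isd t : 0 <= t <= s -> is_derive t 1 g ('D_a f (x + t *: a)).
  move=> /df /(@diff_derivable _ _ _ _ _ a) dt; apply: DeriveDef.
    by move: dt; rewrite /derivable gE.
  by rewrite /derive gE.
have [||t] := @MVT R g (fun t => 'D_a f (x + t *: a)) 0 s s0.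
- by move=> t; rewrite in_itv /= => /andP[t0 ts]; apply: isd; rewrite !ltW.
- apply: derivable_within_continuous => t; rewrite in_itv /= => ts.
  by have [] := isd t ts.
rewrite in_itv /= => ts; rewrite /g scale0r addr0 subr0 mulrC => E.
by exists t.
Qed.

(** The mean value theorem is applied along [a] to the increment of [f] across [s *: b], then along
    [b] to ['D_a f]. The second difference on the left is symmetric in [a] and [b]. *)
Lemma mixed_difference f (U : set V) (x a b : V) (s : R) : open U ->
  Cn 1 U f -> 0 < s ->
  (forall t r, 0 <= t <= s -> 0 <= r <= s -> U (x + t *: a + r *: b)) ->
  exists t r, [/\ 0 < t < s, 0 < r < s &
    f (x + s *: a + s *: b) - f (x + s *: a) - f (x + s *: b) + f x =
    s * (s * 'D_b (fun y => 'D_a f y) (x + t *: a + r *: b))].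
Proof.
move=> oU Cf s0 inU.
have s01 : 0 <= s <= s by rewrite ltW /=.
have s00 : 0 <= (0 : R) <= s by rewrite lexx ltW.
have df y : U y -> differentiable f y by move=> Uy; exact: (Cn_differentiable Cf Uy).
have ds y : differentiable (fun y : V => y + s *: b) y.
  by apply: differentiableD => //; exact: differentiable_cst.
have dfs y : U (y + s *: b) -> differentiable (fun y => f (y + s *: b)) y.
  move=> Uy; exact: (@differentiable_comp _ _ _ _ (fun y => y + s *: b) f y (ds y) (df _ Uy)).
have dfsE y : U (y + s *: b) -> 'D_a (fun y => f (y + s *: b)) y = 'D_a f (y + s *: b).
  move=> Uy; have q : (fun h : R => h^-1 *: (f (h *: a + y + s *: b) - f (y + s *: b))) =
      (fun h => h^-1 *: (f (h *: a + (y + s *: b)) - f (y + s *: b))).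
    by apply/funext => h; rewrite addrA.
  by rewrite /derive q.
pose F y : R^o := f (y + s *: b) - f y.
have U0 t : 0 <= t <= s -> U (x + t *: a).
  by move=> ts; have := inU t 0 ts s00; rewrite scale0r addr0.
have [t ts|t ts E] := MVT_line (f := F) (x := x) (a := a) s0.
  by apply: differentiableB; [exact: dfs (inU _ _ ts s01)|exact: df (U0 _ ts)].
have ts' : 0 <= t <= s by case/andP: ts => *; rewrite !ltW.
have dF : 'D_a F (x + t *: a) = 'D_a f (x + t *: a + s *: b) - 'D_a f (x + t *: a).
  rewrite /F -(dfsE _ (inU _ _ ts' s01)).
  rewrite -deriveB //; apply: diff_derivable.
    exact: dfs (inU _ _ ts' s01).
  exact: df (U0 _ ts').
have [r rs|r rs E2] := MVT_line (f := fun y => 'D_a f y) (x := x + t *: a) (a := b) s0.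
  exact: (Cn_differentiable (Cn_derive a Cf) (inU _ _ ts' rs)).
exists t, r; split=> //; rewrite -E2 -dF -E /F.
by rewrite (addrAC x) opprD opprK addrA [x + _ + _]addrAC.
Qed.

(** The symmetric second difference is s^2 times either mixed derivative, each taken at some point
    of a small ball around [x]; continuity of both at [x] makes them agree within any [e]. *)
Lemma Schwarz f (U : set V) (x a b : V) : open U -> Cinfty U f -> U x ->
  'D_a (fun y => 'D_b f y) x = 'D_b (fun y => 'D_a f y) x.
Proof.
move=> oU Cf Ux.
pose g1 : V -> R^o := fun y => 'D_b (fun y => 'D_a f y) y.
pose g2 : V -> R^o := fun y => 'D_a (fun y => 'D_b f y) y.
have c1 : {for x, continuous g1}.
  apply: differentiable_continuous; apply: (@Cinfty_differentiable _ _ _ U) => //.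
  by apply: Cinfty_derive; exact: Cinfty_derive.
have c2 : {for x, continuous g2}.
  apply: differentiable_continuous; apply: (@Cinfty_differentiable _ _ _ U) => //.
  by apply: Cinfty_derive; exact: Cinfty_derive.
have Cf1 : Cn 1 U f by move/CinftyP: Cf.
change (g2 x = g1 x); apply/eqP; rewrite -subr_eq0 -normr_le0.
apply/ler_addgt0Pl => _/posnumP[e]; rewrite addr0.
have e2 : 0 < e%:num / 2 by [].
have nU : nbhs x U by exact: open_nbhs_nbhs (conj oU Ux).
have [dU /= dU0 hU] := (nbhs_ballP _ _).1 nU.
have [d1 /= d10 h1] := (nbhs_ballP _ _).1 ((cvgrPdist_lt _ _).1 c1 _ e2).
have [d2 /= d20 h2] := (nbhs_ballP _ _).1 ((cvgrPdist_lt _ _).1 c2 _ e2).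
pose r := Num.min dU (Num.min d1 d2).
have r0 : 0 < r by rewrite !lt_min dU0 d10.
have hd y : ball x r y -> [/\ U y, `|g1 x - g1 y| < e%:num / 2 & `|g2 x - g2 y| < e%:num / 2].
  move=> xy; split; [apply: hU|apply: h1|apply: h2]; apply: le_ball xy.
  - by rewrite ge_min lexx.
  - by rewrite !ge_min lexx orbT.
  - by rewrite !ge_min lexx !orbT.
(* With this [s] the parallelogram spanned by [s *: a] and [s *: b] at [x] stays in the ball of
   radius [r]; the summand 1 keeps the denominator positive and the bound strict. *)
pose s := r / (`|a| + `|b| + 1).
have n0 : 0 < `|a| + `|b| + 1 by rewrite ltr_wpDl ?addr_ge0.
have s0 : 0 < s by rewrite divr_gt0.
have inb t q : 0 <= t <= s -> 0 <= q <= s -> ball x r (x + t *: a + q *: b).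
  move=> /andP[t0 ts] /andP[q0 qs]; rewrite -ball_normE /= -addrA opprD addrA subrr sub0r normrN.
  apply: le_lt_trans (ler_normD _ _) _; rewrite !normrZ !ger0_norm //.
  apply: (@le_lt_trans _ _ (s * `|a| + s * `|b|)).
    by apply: lerD; apply: ler_wpM2r.
  rewrite -mulrDr /s mulrAC ltr_pdivrMr // ltr_pM2l //.
  by rewrite ltrDl.
have W p : 0 < p < s -> 0 <= p <= s by case/andP => *; rewrite !ltW.
have [t [q [ts qs E1]]] := @mixed_difference f U x a b s oU Cf1 s0
  (fun t q ht hq => let: And3 h _ _ := hd _ (inb t q ht hq) in h).
have inb' p1 p2 : 0 <= p1 <= s -> 0 <= p2 <= s -> ball x r (x + p1 *: b + p2 *: a).
  by move=> ht hq; rewrite addrAC; exact: inb.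
have [t' [q' [ts' qs' E2]]] := @mixed_difference f U x b a s oU Cf1 s0
  (fun t q ht hq => let: And3 h _ _ := hd _ (inb' t q ht hq) in h).
have E : g1 (x + t *: a + q *: b) = g2 (x + t' *: b + q' *: a).
  have sn : s != 0 by rewrite gt_eqF.
  have sK (u w : R) : s * (s * u) = s * (s * w) -> u = w.
    by move=> /(mulfI sn)/(mulfI sn).
  apply: sK; refine (etrans (esym E1) (etrans _ E2)).
  by rewrite (addrAC x (s *: b)) -(addrA (f _)) -(addrA (f _)) -!addrA [- _ + (- _ + _)]addrCA.
have [_ k1 _] := hd _ (inb _ _ (W _ ts) (W _ qs)).
have [_ _ k2] := hd _ (inb' _ _ (W _ ts') (W _ qs')).
rewrite (_ : g2 x - g1 x = (g2 x - g2 (x + t' *: b + q' *: a)) -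
    (g1 x - g1 (x + t *: a + q *: b))); last first.
  by rewrite E opprB addrA subrK.
refine (le_trans (ler_normB _ _) _).
have -> : e%:num = e%:num / 2 + e%:num / 2 by exact: splitr.
exact: (lerD (ltW k2) (ltW k1)).
Qed.

End Schwarz.

(** * First and second derivatives of maps between row spaces *)

#[local] Hint Extern 0 (has_coordinates _) => exact: has_coordinates_rV : core.
#[local] Hint Extern 0 (has_coordinates _) => exact: has_coordinates_R : core.

Section derive_rules.
Context {R : realType} {V W X : normedModType R}.

Lemma derive_comp (f : W -> X) (g : V -> W) (x v : V) :
  differentiable g x -> differentiable f (g x) ->
  differentiable (fun y => f (g y)) x /\
  'D_v (fun y => f (g y)) x = 'D_('D_v g x) f (g x).
Proof.
move=> dg df.
have dfg : differentiable (f \o g) x by exact: differentiable_comp.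
split=> //; rewrite (deriveE _ dfg) (diff_comp dg df) /= -(deriveE _ dg).
by rewrite [RHS]deriveE.
Qed.

Lemma derive_linear_comp (f : W -> X) (g : V -> W) (x v : V) :
  has_coordinates W -> linear f -> differentiable g x ->
  differentiable (fun y => f (g y)) x /\
  'D_v (fun y => f (g y)) x = f ('D_v g x).
Proof.
move=> cW lf dg.
have df : differentiable f (g x).
  by apply: (@Cinfty_differentiable _ _ _ setT) => //; exact: Cinfty_linear.
have [h ->] := derive_comp v dg df; split=> //.
by rewrite derive_linear.
Qed.

Lemma derive_sum_scale n (c : 'I_n -> V -> R^o) (f : 'I_n -> V -> W) (x v : V) :
  (forall i, differentiable (c i) x) -> (forall i, differentiable (f i) x) ->
  differentiable (fun y => \sum_i c i y *: f i y) x /\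
  'D_v (fun y => \sum_i c i y *: f i y) x =
  \sum_i (c i x *: 'D_v (f i) x + 'D_v (c i) x *: f i x).
Proof.
move=> dc df.
have -> : (fun y => \sum_i c i y *: f i y) = \sum_i (fun y => c i y *: f i y).
  by apply/funext => y; rewrite fct_sumE.
have D i := derive_scale v (dc i) (df i).
split; first by apply: differentiable_sum => i; have [] := D i.
rewrite derive_sum; last by move=> i; apply: diff_derivable; have [] := D i.
by apply: eq_bigr => i _; have [_ ->] := D i.
Qed.

End derive_rules.

Section row_derivatives.
Context {R : realType}.
Implicit Types k l n : nat.

(** The transpose of the usual Jacobian: vectors are rows and matrices act on the right, so the
    chain rule reads [jac g *m jac f]. *)
Definition jac k n (f : 'rV[R]_k -> 'rV[R]_n) (u : 'rV[R]_k) : 'M[R]_(k, n) :=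
  \matrix_(a, i) ('D_(delta_mx 0 a) f u) 0 i.

Definition hess k n (f : 'rV[R]_k -> 'rV[R]_n) (u : 'rV[R]_k) (a b : 'I_k) :
    'rV[R]_n :=
  'D_(delta_mx 0 a) (fun w => 'D_(delta_mx 0 b) f w) u.

Lemma row_jac k n (f : 'rV[R]_k -> 'rV[R]_n) u a :
  row a (jac f u) = 'D_(delta_mx 0 a) f u.
Proof. by apply/rowP => i; rewrite !mxE. Qed.

Lemma mul_jac k n (f : 'rV[R]_k -> 'rV[R]_n) u v :
  differentiable f u -> v *m jac f u = 'D_v f u.
Proof.
move=> df; rewrite mulmx_sum_row deriveE // [in RHS](row_sum_delta v) linear_sum.
by apply: eq_bigr => i _; rewrite linearZ row_jac deriveE.
Qed.

Lemma near_eq_jac k n (f g : 'rV[R]_k -> 'rV[R]_n) u :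
  (\forall w \near u, f w = g w) -> jac f u = jac g u.
Proof. by move=> fg; apply/matrixP => a i; rewrite !mxE (near_eq_derive _ fg). Qed.

Lemma eq_jac k n (U : set 'rV[R]_k) (f g : 'rV[R]_k -> 'rV[R]_n) u :
  open U -> (forall w, U w -> f w = g w) -> U u -> jac f u = jac g u.
Proof.
move=> oU fg Uu; apply: near_eq_jac.
by apply: filterS (open_nbhs_nbhs (conj oU Uu)).
Qed.

Lemma eq_hess k n (U : set 'rV[R]_k) (f g : 'rV[R]_k -> 'rV[R]_n) u a b :
  open U -> (forall w, U w -> f w = g w) -> U u -> hess f u a b = hess g u a b.
Proof.
move=> oU fg Uu; have H := open_nbhs_nbhs (conj oU Uu).
apply: near_eq_derive; apply: filterS H => w Uw; apply: near_eq_derive.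
by apply: filterS (open_nbhs_nbhs (conj oU Uw)).
Qed.

Lemma jac_id k (u : 'rV[R]_k) : jac id u = 1%:M.
Proof.
apply/row_matrixP => a; rewrite row_jac derive_id.
by apply/rowP => i; rewrite !mxE eqxx eq_sym.
Qed.

Lemma jac_comp k l n (f : 'rV[R]_l -> 'rV[R]_n) (g : 'rV[R]_k -> 'rV[R]_l) u :
  differentiable g u -> differentiable f (g u) ->
  jac (fun w => f (g w)) u = jac g u *m jac f (g u).
Proof.
move=> dg df; apply/row_matrixP => a; rewrite row_mul !row_jac (mul_jac _ df).
by have [_ ->] := derive_comp (delta_mx 0 a) dg df.
Qed.

Lemma derive_coord k n (f : 'rV[R]_k -> 'rV[R]_n) u v i :
  differentiable f u ->
  differentiable (fun w => f w 0 i : R^o) u /\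
  'D_v (fun w => f w 0 i : R^o) u = ('D_v f u) 0 i.
Proof.
move=> df.
exact: (derive_linear_comp v (has_coordinates_rV n) (@rV_coord_is_linear R n i) df).
Qed.

(** The last summand is a combination of rows of [jac f], hence tangent to the image of [f], and
    drops out of pairings with normal vectors; the rest is quadratic in [jac g]. *)
Lemma hess_comp k l n (U : set 'rV[R]_k) (V : set 'rV[R]_l)
    (f : 'rV[R]_l -> 'rV[R]_n) (g : 'rV[R]_k -> 'rV[R]_l) u a b :
  open U -> Cinfty U g -> Cinfty V f -> (forall w, U w -> V (g w)) -> U u ->
  hess (fun w => f (g w)) u a b =
  \sum_j \sum_i (jac g u b j * jac g u a i) *: hess f (g u) i j
  + hess g u a b *m jac f (g u).
Proof.
move=> oU Cg Cf gV Uu.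
have dg w : U w -> differentiable g w by exact: Cinfty_differentiable.
have df w : U w -> differentiable f (g w).
  by move=> /gV; exact: Cinfty_differentiable.
have d2g w v : U w -> differentiable (fun x => 'D_v g x) w.
  by move=> Uw; apply: (Cinfty_differentiable _ Uw); exact: Cinfty_derive.
have d2f w v : U w -> differentiable (fun x => 'D_v f x) (g w).
  move=> Uw; apply: (Cinfty_differentiable _ (gV _ Uw)); exact: Cinfty_derive.
pose c (j : 'I_l) w : R^o := ('D_(delta_mx 0 b) g w) 0 j.
pose F (j : 'I_l) w := 'D_(delta_mx 0 j) f (g w).
have E w : U w -> 'D_(delta_mx 0 b) (fun w => f (g w)) w = \sum_j c j w *: F j w.
  move=> Uw; have [_ ->] := derive_comp (delta_mx 0 b) (dg _ Uw) (df _ Uw).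
  rewrite -mul_jac ?mulmx_sum_row; last exact: df.
  by apply: eq_bigr => j _; rewrite row_jac.
rewrite /hess (near_eq_derive (g := fun w => \sum_j c j w *: F j w)); last first.
  by apply: filterS (open_nbhs_nbhs (conj oU Uu)).
have dc j : differentiable (c j) u.
  by have [] := derive_coord 0 j (d2g u (delta_mx 0 b) Uu).
have dF j := derive_comp (delta_mx 0 a) (dg _ Uu) (d2f u (delta_mx 0 j) Uu).
have [_ ->] := derive_sum_scale (delta_mx 0 a) dc (fun j => (dF j).1).
rewrite big_split /= mulmx_sum_row; congr (_ + _); apply: eq_bigr => j _.
  rewrite (dF j).2 -mul_jac; last exact: d2f.
  rewrite mulmx_sum_row scaler_sumr; apply: eq_bigr => i _.
  by rewrite scalerA row_jac /c !mxE.
by have [_ ->] := derive_coord (delta_mx 0 a) j (d2g u (delta_mx 0 b) Uu); rewrite row_jac.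
Qed.

Lemma hess_sym k n (U : set 'rV[R]_k) (f : 'rV[R]_k -> 'rV[R]_n) u a b :
  open U -> Cinfty U f -> U u -> hess f u a b = hess f u b a.
Proof.
move=> oU Cf Uu; apply/rowP => i; rewrite /hess.
have d1 w v : U w -> 'D_v (fun w => f w 0 i : R^o) w = ('D_v f w) 0 i.
  by move=> Uw; have [] := derive_coord v i (Cinfty_differentiable Cf Uw).
have d2 v1 v2 : ('D_v1 (fun w => 'D_v2 f w) u) 0 i =
    'D_v1 (fun w => 'D_v2 (fun w => f w 0 i : R^o) w) u.
  have D := Cinfty_differentiable (Cinfty_derive v2 Cf) Uu.
  have [_ <-] := derive_coord v1 i D; apply: near_eq_derive.
  by apply: filterS (open_nbhs_nbhs (conj oU Uu)) => w Uw; rewrite d1.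
have Ci : Cinfty U (fun w => f w 0 i : R^o).
  apply: (@Cinfty_comp _ _ _ _ U setT f (@rV_coord R n i)) => //.
  exact: (Cinfty_linear (U := setT) (has_coordinates_rV n) (@rV_coord_is_linear R n i)).
refine (etrans (d2 _ _) (etrans _ (esym (d2 _ _)))).
exact: Schwarz oU Ci Uu.
Qed.

End row_derivatives.

Section ip.
Context {R : realType} {n : nat} (B : 'M[R]_n).

Lemma ipDl x y z : ip B (x + y) z = ip B x z + ip B y z.
Proof. by rewrite /ip !mulmxDl mxE. Qed.

Lemma ipDr x y z : ip B z (x + y) = ip B z x + ip B z y.
Proof. by rewrite /ip linearD mulmxDr mxE. Qed.

Lemma ipZl a x y : ip B (a *: x) y = a * ip B x y.
Proof. by rewrite /ip -!scalemxAl mxE. Qed.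

Lemma ipZr a x y : ip B x (a *: y) = a * ip B x y.
Proof. by rewrite /ip linearZ -scalemxAr mxE. Qed.

Lemma ipC x y : B^T = B -> ip B x y = ip B y x.
Proof.
move=> sB; have -> : ip B y x = ((y *m B *m x^T)^T) 0 0 by rewrite mxE.
by rewrite !trmx_mul trmxK sB mulmxA.
Qed.

Lemma ip_mxE x y : x *m B *m y^T = (ip B x y)%:M.
Proof. by rewrite [LHS]mx11_scalar. Qed.

Lemma ip_sum_coord y z : ip B y z = \sum_i y 0 i * ip B (delta_mx 0 i) z.
Proof.
rewrite {1}(row_sum_delta y).
elim/big_rec2: _ => [|i p q _ <-]; first by rewrite /ip !mul0mx mxE.
by rewrite ipDl ipZl.
Qed.

Lemma derive_ip (V : normedModType R) (f g : V -> 'rV[R]_n) x v :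
  differentiable f x -> differentiable g x ->
  differentiable (fun y => ip B (f y) (g y) : R^o) x /\
  'D_v (fun y => ip B (f y) (g y) : R^o) x =
  ip B ('D_v f x) (g x) + ip B (f x) ('D_v g x).
Proof.
move=> df dg.
have -> : (fun y => ip B (f y) (g y) : R^o) =
    fun y => \sum_i (rV_coord i (f y)) *: (ip B (delta_mx 0 i) (g y) : R^o).
  by apply/funext => y; rewrite ip_sum_coord.
have D1 i := derive_linear_comp v (has_coordinates_rV n) (rV_coord_is_linear i) df.
have lip i : linear (fun z => ip B (delta_mx 0 i) z : R^o).
  by move=> a y z; rewrite ipDr ipZr.
have D2 i := derive_linear_comp v (has_coordinates_rV n) (lip i) dg.
have [h ->] := derive_sum_scale v (fun i => (D1 i).1) (fun i => (D2 i).1).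
split=> //; rewrite big_split /= addrC; congr (_ + _).
  by rewrite [RHS]ip_sum_coord; apply: eq_bigr => i _; rewrite (D1 i).2.
by rewrite [RHS]ip_sum_coord; apply: eq_bigr => i _; rewrite (D2 i).2.
Qed.

Lemma induced_metricE k (phi : 'rV[R]_k -> 'rV[R]_n) u :
  induced_metric B phi u = jac phi u *m B *m (jac phi u)^T.
Proof.
apply/matrixP => a b; rewrite mxE -!row_jac /ip.
rewrite -row_mul [LHS]mxE [RHS]mxE; apply: eq_bigr => i _.
by congr (_ * _); rewrite !mxE.
Qed.

End ip.

(** * Tension in terms of the second derivative *)

Section tension.
Context {R : realType} {n : nat} (B : 'M[R]_n).
Hypothesis sB : B^T = B.

Lemma mul_form_jac k (phi : 'rV[R]_k -> 'rV[R]_n) u x d :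
  (x *m B *m (jac phi u)^T) 0 d = ip B x ('D_(delta_mx 0 d) phi u).
Proof.
rewrite /ip -row_jac [LHS]mxE [RHS]mxE; apply: eq_bigr => i _.
by congr (_ * _); rewrite !mxE.
Qed.

Section christoffel.
Context {k : nat} (U : set 'rV[R]_k) (phi : 'rV[R]_k -> 'rV[R]_n) (u : 'rV[R]_k).
Hypotheses (oU : open U) (Cphi : Cinfty U phi) (Uu : U u).

Lemma partial_induced_metric a b d :
  partial a (fun w => induced_metric B phi w b d) u =
  ip B (hess phi u a b) ('D_(delta_mx 0 d) phi u) +
  ip B ('D_(delta_mx 0 b) phi u) (hess phi u a d).
Proof.
have D v : differentiable (fun w => 'D_v phi w) u.
  by apply: (Cinfty_differentiable _ Uu); exact: Cinfty_derive.
rewrite /partial.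
have -> : (fun w => induced_metric B phi w b d) = (fun w =>
    ip B ('D_(delta_mx 0 b) phi w) ('D_(delta_mx 0 d) phi w)).
  by apply/funext => w; rewrite mxE.
by have [_ ->] := derive_ip B (delta_mx 0 a) (D (delta_mx 0 b)) (D (delta_mx 0 d)).
Qed.

(* The Koszul formula, for the metric induced by [phi]. *)
Lemma christoffel_induced_metric c a b :
  christoffel (induced_metric B phi) c a b u =
  (hess phi u a b *m B *m (jac phi u)^T *m (invmx (induced_metric B phi u))^T) 0 c.
Proof.
rewrite /christoffel [RHS]mxE mulr_sumr; apply: eq_bigr => d _.
rewrite !partial_induced_metric mul_form_jac [_^T d c]mxE.
(* By symmetry of second derivatives and of [B], four of the six pairings cancel and the other two
   are equal, which absorbs the factor 1/2. *)
have K (t x x' y y' z z' : R) : x' = x -> y' = y -> z' = z ->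
    2^-1 * (t * (x + y + (x' + z) - (y' + z'))) = x * t.
  by move=> -> -> ->; field.
have S a' b' := hess_sym a' b' oU Cphi Uu.
by apply: K; [rewrite (S b a)|rewrite (S d a) ipC|rewrite (S d b)].
Qed.

End christoffel.

Lemma induced_metric_sym k (phi : 'rV[R]_k -> 'rV[R]_n) u :
  (induced_metric B phi u)^T = induced_metric B phi u.
Proof. by rewrite induced_metricE !trmx_mul trmxK sB mulmxA. Qed.

(* The trace of the second derivative; the mean curvature vector is its
   component normal to the image of [phi]. *)
Definition trace_hess k (phi : 'rV[R]_k -> 'rV[R]_n) (u : 'rV[R]_k) : 'rV[R]_n :=
  \sum_a \sum_b invmx (induced_metric B phi u) a b *: hess phi u a b.

Section tension_induced.
Context {k l : nat} (U : set 'rV[R]_k) (V : set 'rV[R]_l)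
  (phi : 'rV[R]_k -> 'rV[R]_n) (chi : 'rV[R]_l -> 'rV[R]_n)
  (F : 'rV[R]_k -> 'rV[R]_l) (u : 'rV[R]_k).
Hypotheses (oU : open U) (Cphi : Cinfty U phi) (CF : Cinfty U F)
  (oV : open V) (Cchi : Cinfty V chi) (FV : forall w, U w -> V (F w))
  (phiE : forall w, U w -> chi (F w) = phi w) (Uu : U u).
Let g := induced_metric B phi u.
Let h := induced_metric B chi (F u).
Let J := jac phi u.
Let C := jac chi (F u).
Let JF := jac F u.
Hypotheses (gU : g \in unitmx) (hU : h \in unitmx).

(** The subtracted term is the tangential projection; its coefficients along the rows of [J] are the
    Christoffel symbols of the source. *)
Let normal_hess a b : 'rV[R]_n :=
  hess phi u a b - (hess phi u a b *m B *m J^T *m invmx g) *m J.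

Let J_E : J = JF *m C.
Proof.
rewrite /J -(eq_jac oU phiE Uu) jac_comp //.
  exact: Cinfty_differentiable Uu.
exact: (Cinfty_differentiable Cchi (FV Uu)).
Qed.

(** Multiplying by [h] clears the inverse in the target Christoffel symbols, and the chain rule for
    [chi] after [F] turns second derivatives of [F] into those of [phi]. The right side pairs the
    mean curvature vector with the tangent vectors of the target. *)
Lemma tension_mul_metric :
  (\row_e tension (induced_metric B phi) (induced_metric B chi) F e u) *m h =
  (\sum_a \sum_b invmx g a b *: normal_hess a b) *m B *m C^T.
Proof.
have dF w : U w -> differentiable F w by exact: Cinfty_differentiable.
have inv_sym m (X : 'M[R]_m) : X^T = X -> (invmx X)^T = invmx X.
  by move=> sX; rewrite trmx_inv sX.
have partialF w e b : U w -> partial b (fun w => F w 0 e) w = ('D_(delta_mx 0 b) F w) 0 e.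
  by move=> Uw; have [_ <-] := derive_coord (delta_mx 0 b) e (dF w Uw).
have partial2F e a b : partial a (partial b (fun w => F w 0 e)) u = (hess F u a b) 0 e.
  have D : differentiable (fun w => 'D_(delta_mx 0 b) F w) u.
    by apply: (Cinfty_differentiable _ Uu); exact: Cinfty_derive.
  have [_ <-] := derive_coord (delta_mx 0 a) e D.
  apply: near_eq_derive; apply: filterS (open_nbhs_nbhs (conj oU Uu)) => w Uw.
  exact: partialF.
(* The bracket of [tension] as a row vector, with both families of Christoffel symbols written as
   projections of second derivatives. *)
pose T a b : 'rV[R]_l := hess F u a b
  - (hess phi u a b *m B *m J^T *m invmx g) *m JF
  + (\sum_j \sum_i (JF b j * JF a i) *: (hess chi (F u) i j *m B *m C^T *m invmx h)).
have -> : (\row_e tension (induced_metric B phi) (induced_metric B chi) F e u) =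
    \sum_a \sum_b invmx g a b *: T a b.
  apply/rowP => e; rewrite mxE /tension summxE; apply: eq_bigr => a _.
  rewrite summxE; apply: eq_bigr => b _; rewrite [RHS]mxE; congr (_ * _).
  rewrite /T [RHS]mxE partial2F [(hess F u a b - _) 0 e]mxE; congr (_ + _).
    congr (_ + _); rewrite mxE; congr (- _); rewrite mxE; apply: eq_bigr => c _.
    rewrite (christoffel_induced_metric oU Cphi Uu) inv_sym ?induced_metric_sym //.
    by rewrite partialF // [JF _ _]mxE.
  rewrite summxE exchange_big; apply: eq_bigr => j _; rewrite summxE.
  apply: eq_bigr => i _; rewrite mxE.
  rewrite (christoffel_induced_metric oV Cchi (FV Uu)) inv_sym ?induced_metric_sym //.
  rewrite !partialF // [JF b j]mxE [JF a i]mxE.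
  by rewrite [LHS]mulrC [LHS]mulrCA [LHS]mulrC.
rewrite !mulmx_suml; apply: eq_bigr => a _; rewrite !mulmx_suml.
apply: eq_bigr => b _; rewrite -!scalemxAl; congr (_ *: _).
have E : hess phi u a b = \sum_j \sum_i (JF b j * JF a i) *: hess chi (F u) i j
    + hess F u a b *m C.
  rewrite -(eq_hess a b oU phiE Uu).
  exact: (hess_comp a b oU CF Cchi FV Uu).
have hE : h = C *m B *m C^T by rewrite /h induced_metricE.
rewrite /T /normal_hess; set Y := _ *m invmx g.
set Z := \sum_j \sum_i (_ * _) *: (_ *m invmx h).
have ZE : Z *m h = (\sum_j \sum_i (JF b j * JF a i) *: hess chi (F u) i j) *m B *m C^T.
  rewrite /Z !mulmx_suml; apply: eq_bigr => j _; rewrite !mulmx_suml.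
  by apply: eq_bigr => i _; rewrite -!scalemxAl mulmxKV.
rewrite E J_E !(mulmxDl, mulNmx) ZE hE !mulmxA.
by rewrite [LHS]addrC addrA.
Qed.

(** The normal part of [trace_hess] is orthogonal to [J], so testing it on all tangent vectors of
    the target amounts to testing it on those normal to the source, where it may be replaced by
    [trace_hess]. Invertibility of [h] recovers the tension from these pairings. *)
Lemma tension_eq0P :
  (forall e, tension (induced_metric B phi) (induced_metric B chi) F e u = 0) <->
  (forall y, J *m B *m (y *m C)^T = 0 -> ip B (trace_hess phi u) (y *m C) = 0).
Proof.
pose S := \sum_a \sum_b invmx g a b *: normal_hess a b.
have gE : g = J *m B *m J^T by rewrite /g induced_metricE.
have nJ a b : normal_hess a b *m B *m J^T = 0.
  by rewrite /normal_hess !mulmxBl -!(mulmxA _ J) -!mulmxA (mulmxA J) -gE mulVmx // mulmx1 subrr.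
have SJ : S *m B *m J^T = 0.
  rewrite /S !mulmx_suml big1 // => a _; rewrite !mulmx_suml big1 // => b _.
  by rewrite -!scalemxAl nJ scaler0.
have SW w : J *m B *m w^T = 0 -> ip B S w = ip B (trace_hess phi u) w.
  move=> Jw; rewrite /ip; congr (fun_of_matrix _ _ _).
  rewrite /S /trace_hess !mulmx_suml; apply: eq_bigr => a _; rewrite !mulmx_suml.
  apply: eq_bigr => b _; rewrite -!scalemxAl; congr (_ *: _).
  by rewrite /normal_hess !mulmxBl -!(mulmxA _ J) -!mulmxA (mulmxA J) Jw !mulmx0 subr0.
split=> [T0 y Jy|H].
  rewrite -SW // /ip trmx_mul mulmxA -tension_mul_metric.
  rewrite (_ : \row_e _ = 0) ?mul0mx ?mxE //.
  by apply/rowP => e; rewrite !mxE.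
have S0 : S *m B *m C^T = 0.
  apply/rowP => d; rewrite [RHS]mxE mul_form_jac -row_jac rowE.
  set y := delta_mx 0 d.
  (* [t *m J] is the projection of [y *m C] onto the source tangent space; the remainder is still a
     combination of rows of [C] because [J = JF *m C]. *)
  pose t := y *m C *m B *m J^T *m invmx g.
  have -> : y *m jac chi (F u) = (y - t *m JF) *m C + t *m J.
    by rewrite mulmxBl -mulmxA -J_E subrK.
  rewrite ipDr {2}/ip trmx_mul mulmxA SJ mul0mx [_ 0 0]mxE addr0.
  have Jw : J *m B *m ((y - t *m JF) *m C)^T = 0.
    apply: trmx_inj; rewrite !trmx_mul !trmxK sB trmx0 mulmxA.
    rewrite mulmxBl -(mulmxA _ JF) -J_E !mulmxBl /t.
    by rewrite -(mulmxA _ J) -(mulmxA _ (J *m B)) -gE mulmxKV // subrr.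
  by rewrite SW // H.
move: tension_mul_metric; rewrite S0 => /(congr1 (mulmx^~ (invmx h))).
rewrite mul0mx mulmxK // => T0 e.
by move/rowP: T0 => /(_ e); rewrite !mxE.
Qed.

End tension_induced.

End tension.

(** * Local parametrizations and harmonicity of inclusions *)

Section smooth_on.
Context {R : realType} {V W : normedModType R}.

Lemma open_preimage (O : set V) (f : V -> W) (A : set W) : open O ->
  (forall x, O x -> {for x, continuous f}) -> open A ->
  open (O `&` f @^-1` A).
Proof.
move=> oO cf oA; rewrite openE => x [Ox Ax].
apply: filterI; first exact: open_nbhs_nbhs (conj oO Ox).
by apply: cf => //; exact: open_nbhs_nbhs (conj oA Ax).
Qed.

Lemma Cinfty_open_preimage (O : set V) (f : V -> W) (A : set W) : open O ->
  Cinfty O f -> open A -> open (O `&` f @^-1` A).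
Proof.
move=> oO Cf; apply: open_preimage oO _ => x Ox.
exact: differentiable_continuous (Cinfty_differentiable Cf Ox).
Qed.

Lemma smooth_on_open (U : set V) (f : V -> W) : open U ->
  smooth_on U f <-> Cinfty U f.
Proof.
move=> oU; split=> [sf|Cf x Ux]; last by exists U, f; split.
apply: Cinfty_locally => x Ux; have [ O [F [oO Ox CF FE]]] := (sf x Ux).
have oOU : open (O `&` U) by exact: openI.
exists (O `&` U) => //.
apply: eq_Cinfty oOU _ (Cinfty_sub _ CF); last by move=> y [].
by move=> y [Oy Uy]; exact: FE.
Qed.

End smooth_on.

Section charts.
Context {R : realType} {n : nat}.
Implicit Types (M : set 'rV[R]_n).

(** The third condition also says that [M] meets [Om] only inside the image of [phi], so relative
    openness of the image is built in. *)
Definition local_inverse M k (U : set 'rV[R]_k) (phi : 'rV[R]_k -> 'rV[R]_n)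
    (Om : set 'rV[R]_n) (G : 'rV[R]_n -> 'rV[R]_k) : Prop :=
  [/\ open Om, Cinfty Om G, (forall z, Om z -> M z -> U (G z) /\ phi (G z) = z) &
      forall u, U u -> Om (phi u) -> G (phi u) = u].

(** Smoothness of the inverse and relative openness of the image are local, so exhibiting some [G]
    near each point suffices; two preimages of one point are identified by a common [G]. *)
Lemma local_parametrizationP M k (U : set 'rV[R]_k) phi :
  local_parametrization M U phi <->
  [/\ open U, Cinfty U phi, (forall u, U u -> M (phi u)) &
    forall u, U u -> exists Om G, Om (phi u) /\ local_inverse M U phi Om G].
Proof.
split=> [[oU [_ sphi [g [gK sg]]] [ O [oO OE]]]|[oU Cphi UM inv]].
  split=> // [|u Uu|u Uu].
  - exact/smooth_on_open.
  - have : (phi @` U) (phi u) by exists u.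
    by rewrite OE => -[].
  - have pu : (phi @` U) (phi u) by exists u.
    have [Om [G [oOm Omu CG GE]]] := sg _ pu.
    exists (Om `&` O), G; split; first by split=> //; move: pu; rewrite OE => -[].
    split.
    + exact: openI.
    + by apply: Cinfty_sub CG => z [].
    + move=> z [Omz Oz] Mz; have : (phi @` U) z by rewrite OE.
      move=> [u' Uu' u'z]; rewrite (GE _ Omz (ex_intro2 _ _ u' Uu' u'z)).
      by rewrite -u'z gK.
    + move=> u' Uu' [Omu' _]; rewrite (GE _ Omu' (ex_intro2 _ _ u' Uu' erefl)).
      exact: gK.
have inj u u' : U u -> U u' -> phi u = phi u' -> u = u'.
  move=> Uu Uu' E; have [Om [G [Omu [_ _ _ GK]]]] := inv u Uu.
  by rewrite -(GK u) // E GK // -E.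
(* Choice provides a global inverse; on the image it agrees locally with a smooth [G], and the
   default 0 occurs only off the image. *)
pose g z := xget 0 [set u | U u /\ phi u = z].
have gK u : U u -> g (phi u) = u.
  by move=> Uu; rewrite /g; case: xgetP => [u' -> [Uu' E]|/(_ u)[]]; first exact: inj.
split=> //.
  split=> //; first exact/smooth_on_open.
  exists g; split=> // _ [u Uu <-].
  have [Om [G [Omu [oOm CG GM GK]]]] := inv u Uu.
  exists Om, G; split=> // z Omz [u' Uu' u'z].
  by rewrite -u'z gK // GK // u'z.
exists (\bigcup_(O in [set O | open O /\ O `&` M `<=` phi @` U]) O); split.
  by apply: bigcup_open => O [].
apply/seteqP; split=> [_ [u Uu <-]|z [Mz [ O [oO OU] Oz]]]; last exact: OU.
split; first exact: UM.
have [Om [G [Omu [oOm CG GM GK]]]] := inv u Uu.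
exists Om => //; split=> // z [Omz Mz]; have [UG E] := GM z Omz Mz.
by exists (G z).
Qed.

Lemma local_parametrization_sub M k (U U' : set 'rV[R]_k) phi :
  open U' -> U' `<=` U -> local_parametrization M U phi ->
  local_parametrization M U' phi.
Proof.
move=> oU' sU /local_parametrizationP[oU Cphi UM inv].
apply/local_parametrizationP; split=> //.
- exact: Cinfty_sub Cphi.
- by move=> u /sU; exact: UM.
- move=> u U'u; have [Om [G [Omu [oOm CG GM GK]]]] := inv u (sU _ U'u).
  exists (Om `&` G @^-1` U'), G; split; first by split=> //; rewrite /preimage /= GK //; exact: sU.
  split.
  + exact: Cinfty_open_preimage.
  + by apply: Cinfty_sub CG => z [].
  + by move=> z [Omz U'z] Mz; have [] := GM z Omz Mz.
  + by move=> u' /sU Uu' [Omu' _]; exact: GK.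
Qed.

(** Composing with [G] lifts a smooth map into [M] through the chart, once its domain is cut down to
    the preimage of [Om]. This gives changes of charts as well as coordinate expressions of maps. *)
Lemma param_factor M k (U : set 'rV[R]_k) phi j (O : set 'rV[R]_j)
    (f : 'rV[R]_j -> 'rV[R]_n) x u :
  local_parametrization M U phi -> U u -> open O -> Cinfty O f -> O x ->
  (forall w, O w -> M (f w)) -> f x = phi u ->
  exists O' (y : 'rV[R]_j -> 'rV[R]_k),
    [/\ open O', O' x, O' `<=` O, Cinfty O' y &
        [/\ (forall w, O' w -> U (y w)), (forall w, O' w -> phi (y w) = f w) & y x = u]].
Proof.
move=> /local_parametrizationP[oU Cphi UM inv] Uu oO Cf Ox OM fx.
have [Om [G [Omu [oOm CG GM GK]]]] := inv u Uu.
have oO' : open (O `&` f @^-1` Om) by exact: Cinfty_open_preimage.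
exists (O `&` f @^-1` Om), (fun w => G (f w)); split.
- exact: oO'.
- by split=> //; rewrite /preimage /= fx.
- by move=> w [].
- apply: (Cinfty_comp _ oO' _ _ CG) => //; first by move=> w [].
  by apply: Cinfty_sub Cf => w [].
- split.
  + by move=> w [Ow Omw]; have [] := GM _ Omw (OM _ Ow).
  + by move=> w [Ow Omw]; have [] := GM _ Omw (OM _ Ow).
  + by rewrite fx GK.
Qed.

(** Differentiating the lift through the chart: the row space of a chart contains every vector
    tangent to [M], so it does not depend on the chart. *)
Lemma param_jac_factor M k (U : set 'rV[R]_k) phi j (O : set 'rV[R]_j)
    (f : 'rV[R]_j -> 'rV[R]_n) x u :
  local_parametrization M U phi -> U u -> open O -> Cinfty O f -> O x ->
  (forall w, O w -> M (f w)) -> f x = phi u ->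
  exists Y : 'M[R]_(j, k), jac f x = Y *m jac phi u.
Proof.
move=> Lphi Uu oO Cf Ox OM fx.
have [oU Cphi _ _] := (local_parametrizationP _ _ _).1 Lphi.
have [ O' [y [oO' O'x sO Cy [yU yE yx]]]] := param_factor Lphi Uu oO Cf Ox OM fx.
have dy := Cinfty_differentiable Cy O'x.
have dphi : differentiable phi (y x).
  by rewrite yx; exact: Cinfty_differentiable Cphi Uu.
by exists (jac y x); rewrite -(eq_jac oO' yE O'x) (jac_comp dy dphi) yx.
Qed.

Lemma param_jac_inv M k (U : set 'rV[R]_k) phi u :
  local_parametrization M U phi -> U u ->
  exists K : 'M[R]_(n, k), jac phi u *m K = 1%:M.
Proof.
move=> Lphi Uu.
have [oU Cphi UM inv] := (local_parametrizationP _ _ _).1 Lphi.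
have [Om [G [Omu [oOm CG GM GK]]]] := inv u Uu.
have dphi := Cinfty_differentiable Cphi Uu.
have dG := Cinfty_differentiable CG Omu.
exists (jac G (phi u)); rewrite -(jac_comp dphi dG) -[RHS](jac_id u).
apply: (@eq_jac _ _ _ (U `&` phi @^-1` Om)) => //.
  exact: Cinfty_open_preimage.
by move=> w [Uw Omw]; exact: GK.
Qed.

Lemma param_jac_inj M k (U : set 'rV[R]_k) phi u (v : 'rV[R]_k) :
  local_parametrization M U phi -> U u -> v *m jac phi u = 0 -> v = 0.
Proof.
move=> Lphi Uu v0; have [K JK] := param_jac_inv Lphi Uu.
by rewrite -[v]mulmx1 -JK mulmxA v0 mul0mx.
Qed.

End charts.

Section metrics.
Context {R : realType} {n : nat} (B : 'M[R]_n).

Lemma ip_induced_metric k (phi : 'rV[R]_k -> 'rV[R]_n) u v w :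
  ip (induced_metric B phi u) v w = ip B (v *m jac phi u) (w *m jac phi u).
Proof. by rewrite /ip induced_metricE trmx_mul !mulmxA. Qed.

Lemma unitmx_of_form k (g : 'M[R]_k) :
  (forall v, (forall w, ip g v w = 0) -> v = 0) -> g \in unitmx.
Proof.
move=> H; rewrite -row_free_unit; apply: inj_row_free => v vg.
by apply: H => w; rewrite /ip vg mul0mx mxE.
Qed.

Lemma positive_definite_nondegenerate (M : set 'rV[R]_n) :
  positive_definite_metric B M -> nondegenerate_metric B M.
Proof.
move=> pd k U phi Lphi u Uu; apply: unitmx_of_form => v H.
apply/eqP/negPn/negP => v0.
by have := pd _ _ _ Lphi _ _ Uu v0; rewrite H ltxx.
Qed.

(* [TN v] stands for the tangent space at [v] of the submanifold [N]. *)
Definition nondegenerate_target (N : set 'rV[R]_n)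
    (TN : 'rV[R]_n -> 'rV[R]_n -> Prop) : Prop :=
  (forall v, N v -> exists l (V : set 'rV[R]_l) chi y,
     [/\ local_parametrization N V chi, V y & chi y = v]) /\
  (forall l (V : set 'rV[R]_l) chi y, local_parametrization N V chi -> V y ->
     induced_metric B chi y \in unitmx /\
     forall w, TN (chi y) w <-> exists x, w = x *m jac chi y).

Hypothesis sB : B^T = B.

(** [tension_eq0P] settles one pair of charts with one coordinate expression [F]. To use
    harmonicity, a target chart must be produced and the source shrunk until [F] exists; to prove
    it, an arbitrary [F] must be shown smooth. *)
Lemma harmonic_idP (N M : set 'rV[R]_n) (TN : 'rV[R]_n -> 'rV[R]_n -> Prop) :
  nondegenerate_target N TN -> nondegenerate_metric B M -> M `<=` N ->
  Defs.harmonic B M N id <->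
  forall k (U : set 'rV[R]_k) phi, local_parametrization M U phi ->
    forall u w, U u -> TN (phi u) w -> jac phi u *m B *m w^T = 0 ->
    ip B (trace_hess B phi u) w = 0.
Proof.
move=> [exN tgN] ndM MN; split=> [[_ _ har] k U phi Lphi u w Uu Tw Jw|H].
  have [oU Cphi UM _] := (local_parametrizationP _ _ _).1 Lphi.
  have [l [V [chi [y [Lchi Vy chiy]]]]] := exN _ (MN _ (UM _ Uu)).
  have [oV Cchi VN _] := (local_parametrizationP _ _ _).1 Lchi.
  have [U' [F [oU' U'u sU CF [FV FE Fu]]]] :=
    param_factor Lchi Vy oU Cphi Uu (fun w Uw => MN _ (UM w Uw)) (esym chiy).
  have Lphi' := local_parametrization_sub oU' sU Lphi.
  have VFu : V (F u) by exact: FV.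
  have [hU] := tgN _ _ _ _ Lchi VFu; rewrite FE // => /(_ w)[/(_ Tw)[x wE] _].
  have gU := ndM _ _ _ Lphi _ Uu.
  have T0 := har _ _ _ _ _ _ F Lphi' Lchi (fun w Uw => conj (FV w Uw) (FE w Uw)) u.
  have Cphi' := Cinfty_sub sU Cphi.
  have [/(_ (fun e => T0 e U'u)) E _] :=
    tension_eq0P sB oU' Cphi' CF oV Cchi FV FE U'u gU hU.
  by rewrite wE E // -wE.
split=> // [x Mx|_ [x Mx <-]|]; first by exists setT, id; split=> //;
  [exact: openT|apply/CinftyP => k; exact: Cn_id].
  exact: MN.
move=> k l U phi V chi F Lphi Lchi UF u e Uu.
have [oU Cphi UM _] := (local_parametrizationP _ _ _).1 Lphi.
have [oV Cchi VN inv] := (local_parametrizationP _ _ _).1 Lchi.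
have FV w : U w -> V (F w) by case/UF.
have FE w : U w -> chi (F w) = phi w by case/UF.
(* Only [chi (F w) = phi w] is given; locally this makes [F] the composite of [G] with [phi], hence
   smooth. *)
have CF : Cinfty U F.
  apply: Cinfty_locally => w Uw.
  have [Om [G [Omw [oOm CG GM GK]]]] := inv _ (FV _ Uw).
  have oU' : open (U `&` phi @^-1` Om) by exact: Cinfty_open_preimage.
  exists (U `&` phi @^-1` Om).
    by split=> //; split=> //; rewrite /preimage /= -FE.
  apply: (@eq_Cinfty _ _ _ _ (fun w => G (phi w))) => //.
    by move=> w' [Uw' Omw']; rewrite -FE // GK // ?FE //; exact: FV.
  apply: (Cinfty_comp _ oU' _ _ CG) => //; first by move=> w' [].
  by apply: Cinfty_sub Cphi => w' [].
have [hU TE] := tgN _ _ _ _ Lchi (FV _ Uu).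
have gU := ndM _ _ _ Lphi _ Uu.
apply: (tension_eq0P sB oU Cphi CF oV Cchi FV FE Uu gU hU).2 => y Jy.
apply: (H _ _ _ Lphi _ _ Uu _ Jy).
by rewrite -(FE _ Uu); apply: (TE _).2; exists y.
Qed.

(** The maps [rho] replace a dimension count: [rho] takes values in [N] and its derivative at [v]
    fixes [w], so [w] lies in the row space of every chart at [v]. Nondegeneracy of [B] on [TN v]
    then makes the metric invertible. *)
Lemma nondegenerate_targetI (N : set 'rV[R]_n)
    (TN : 'rV[R]_n -> 'rV[R]_n -> Prop) :
  (forall v, N v -> exists l (V : set 'rV[R]_l) chi y,
     [/\ local_parametrization N V chi, V y & chi y = v]) ->
  (forall l (V : set 'rV[R]_l) chi y x, local_parametrization N V chi -> V y ->
     TN (chi y) (x *m jac chi y)) ->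
  (forall v w, N v -> TN v w -> exists O rho, [/\ open O /\ O v, Cinfty O rho,
     (forall z, O z -> N (rho z)), rho v = v & w *m jac rho v = w]) ->
  (forall v w, N v -> TN v w -> (forall w', TN v w' -> ip B w w' = 0) -> w = 0) ->
  nondegenerate_target N TN.
Proof.
move=> exN JN retr nd; split=> // l V chi y Lchi Vy.
have [oV Cchi VN _] := (local_parametrizationP _ _ _).1 Lchi.
have TE w : TN (chi y) w <-> exists x, w = x *m jac chi y.
  split=> [Tw|[x ->]]; last exact: JN Lchi Vy.
  have [ O [rho [[oO Ov] Crho ON rhov rhow]]] := retr _ _ (VN _ Vy) Tw.
  have [Y YE] := param_jac_factor Lchi Vy oO Crho Ov ON rhov.
  by exists (w *m Y); rewrite -mulmxA -YE rhow.
split=> //; apply: unitmx_of_form => v H; apply: (param_jac_inj Lchi Vy).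
apply: (nd _ _ (VN _ Vy)); first by apply: (TE _).2; exists v.
by move=> w /(TE w).1[x ->]; rewrite -ip_induced_metric.
Qed.

End metrics.

(** * Flat space and the quadric as targets *)

Section targets.
Context {R : realType} {n : nat} (B : 'M[R]_n).

Lemma Cinfty_ip (V : normedModType R) (U : set V) (f g : V -> 'rV[R]_n) :
  open U -> Cinfty U f -> Cinfty U g ->
  Cinfty U (fun x => ip B (f x) (g x) : R^o).
Proof.
move=> oU Cf Cg; apply/CinftyP => k.
have -> : (fun x => ip B (f x) (g x) : R^o) =
    fun x => \sum_i (rV_coord i (f x)) *: (ip B (delta_mx 0 i) (g x) : R^o).
  by apply/funext => x; rewrite ip_sum_coord.
have lip i : linear (fun z => ip B (delta_mx 0 i) z : R^o).
  by move=> a y z; rewrite ipDr ipZr.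
apply: Cn_sum => // i; apply: Cn_scale => //.
  have C1 := Cinfty_linear (U := setT) (has_coordinates_rV n) (@rV_coord_is_linear R n i).
  by have /CinftyP := Cinfty_comp (has_coordinates_rV n) oU (fun x _ => I) Cf C1; apply.
have C2 := Cinfty_linear (U := setT) (has_coordinates_rV n) (lip i).
by have /CinftyP := Cinfty_comp (has_coordinates_rV n) oU (fun x _ => I) Cg C2; apply.
Qed.

Hypotheses (sB : B^T = B) (uB : B \in unitmx).

Lemma ip0l x : ip B 0 x = 0. Proof. by rewrite /ip !mul0mx mxE. Qed.
Lemma ipNl x y : ip B (- x) y = - ip B x y.
Proof. by rewrite -scaleN1r ipZl mulN1r. Qed.
Lemma ipNr x y : ip B x (- y) = - ip B x y.
Proof. by rewrite -scaleN1r ipZr mulN1r. Qed.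

Lemma ip_nondegenerate w : (forall z, ip B w z = 0) -> w = 0.
Proof.
move=> H; suff : w *m B = 0 by move=> /(congr1 (mulmx^~ (invmx B))); rewrite mulmxK // mul0mx.
apply/rowP => i; rewrite [RHS]mxE -(H (delta_mx 0 i)) /ip.
by rewrite trmx_delta -colE [RHS]mxE.
Qed.

Lemma nondegenerate_target_setT :
  nondegenerate_target B setT (fun _ _ => True).
Proof.
have Cid : Cinfty setT (@id 'rV[R]_n) by apply/CinftyP => k; exact: Cn_id.
apply: nondegenerate_targetI => //.
- move=> v _; exists n, setT, id, v; split=> //.
  apply/local_parametrizationP; split=> //; first exact: openT.
  by move=> u _; exists setT, id; split=> //; split=> //; exact: openT.
- move=> v w _ _; exists setT, id; split=> //; first by split=> //; exact: openT.
  by rewrite jac_id mulmx1.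
- by move=> v w _ _ H; apply: ip_nondegenerate => z; exact: H.
Qed.

(** The radial coordinate on a cone over part of the quadric. [Num.sqrt] is 0 on nonpositive
    arguments, so smoothness is claimed on spacelike vectors only. *)
Definition pnorm (z : 'rV[R]_n) : R^o := Num.sqrt (ip B z z).

Lemma ipZZ (a : R) z : ip B (a *: z) (a *: z) = a ^+ 2 * ip B z z.
Proof. by rewrite ipZl ipZr mulrA -expr2. Qed.

Lemma open_spacelike : open [set z | 0 < ip B z z].
Proof.
have Cid : Cinfty setT (@id 'rV[R]_n) by apply/CinftyP => k; exact: Cn_id.
have := Cinfty_open_preimage openT (Cinfty_ip openT Cid Cid) (@open_gt R 0).
by rewrite setTI.
Qed.

Lemma Cinfty_pnorm : Cinfty [set z | 0 < ip B z z] pnorm.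
Proof.
have Cid U : Cinfty U (@id 'rV[R]_n) by apply/CinftyP => k; exact: Cn_id.
apply: Cinfty_sqrt => //; first exact: open_spacelike.
by apply: Cinfty_ip => //; exact: open_spacelike.
Qed.

(** The radial retraction of spacelike vectors onto the quadric; with [pnorm] it inverts the
    multiplication of points of the quadric by positive radii. *)
Definition punit (z : 'rV[R]_n) : 'rV[R]_n := (pnorm z)^-1 *: z.

Lemma Cinfty_punit : Cinfty [set z | 0 < ip B z z] punit.
Proof.
have Cid U : Cinfty U (@id 'rV[R]_n) by apply/CinftyP => k; exact: Cn_id.
apply: Cinfty_scale => //; first exact: open_spacelike.
apply: Cinfty_inv; [exact: open_spacelike| |exact: Cinfty_pnorm].
by move=> z z0; rewrite gt_eqF // sqrtr_gt0.
Qed.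

Lemma quadric_punit z : 0 < ip B z z -> quadric B (punit z).
Proof.
move=> z0; rewrite /quadric /= ipZZ exprVn sqr_sqrtr ?ltW // mulVf //.
by rewrite gt_eqF.
Qed.

Lemma pnormZ r s : 0 < r -> quadric B s -> pnorm (r *: s) = r.
Proof.
by move=> r0 Qs; rewrite /pnorm ipZZ Qs mulr1 sqrtr_sqr gtr0_norm.
Qed.

Lemma punitZ r s : 0 < r -> quadric B s -> punit (r *: s) = s.
Proof.
move=> r0 Qs; rewrite /punit pnormZ // scalerA mulVf ?scale1r //.
by rewrite gt_eqF.
Qed.

(** The derivative of [pnorm] along [w] is a multiple of <v, w>, hence 0, so only the factor
    [(pnorm v)^-1], equal to 1, acts on [w]. Thus [punit] can serve as [rho] in
    [nondegenerate_targetI]. *)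
Lemma jac_punit v w : quadric B v -> ip B v w = 0 -> w *m jac punit v = w.
Proof.
move=> Qv vw; have v0 : 0 < ip B v v by rewrite Qv.
rewrite mul_jac; last exact: Cinfty_differentiable Cinfty_punit v0.
have dp := Cinfty_differentiable Cinfty_pnorm v0.
have pn0 : pnorm v != 0 by rewrite gt_eqF // sqrtr_gt0.
have [di DE] := derive_inv w dp pn0.
have did : differentiable (@id 'rV[R]_n) v by exact: Cn_differentiable (Cn_id 0 setT) I.
have Dpu : 'D_w punit v = (pnorm v)^-1 *: 'D_w id v + 'D_w (fun y => (pnorm y)^-1 : R^o) v *: v.
  exact: (derive_scale w di did).2.
have Dip : 'D_w (fun y => ip B y y : R^o) v = ip B ('D_w id v) v + ip B v ('D_w id v).
  exact: (derive_ip B w did did).2.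
have dip : differentiable (fun y => ip B y y : R^o) v by exact: (derive_ip B w did did).1.
have Dp : 'D_w pnorm v = (2 * pnorm v)^-1 * 'D_w (fun y => ip B y y : R^o) v.
  exact: (derive_sqrt_comp w dip v0).2.
rewrite Dpu DE Dp Dip derive_id vw ipC // vw addr0 !mulr0 scale0r addr0.
by rewrite /pnorm Qv sqrtr1 invr1 scale1r.
Qed.

(** Differentiating <phi, phi> = 1 gives twice this pairing. *)
Lemma param_orthogonal k (M : set 'rV[R]_n) (U : set 'rV[R]_k) phi u (x : 'rV[R]_k) :
  M `<=` quadric B -> local_parametrization M U phi -> U u ->
  ip B (phi u) (x *m jac phi u) = 0.
Proof.
move=> MQ /local_parametrizationP[oU Cphi UM _] Uu.
have dphi := Cinfty_differentiable Cphi Uu.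
rewrite mul_jac //.
have [_] := derive_ip B x dphi dphi.
rewrite (near_eq_derive (g := cst (1 : R^o))); last first.
  by apply: filterS (open_nbhs_nbhs (conj oU Uu)) => w /UM /MQ.
rewrite derive_cst (ipC ('D_x phi u)) // => /esym/eqP.
by rewrite -mulr2n mulrn_eq0 /= => /eqP.
Qed.

(** Near [v] the quadric is the graph of y -> sqrt (1 - <y, y>) v + y over the orthogonal complement
    of [v]; on the half-space <z, v> > 0 the inverse is orthogonal projection. *)
Lemma exists_quadric_chart v : quadric B v ->
  exists l (V : set 'rV[R]_l) chi y,
     [/\ local_parametrization (quadric B) V chi, V y & chi y = v].
Proof.
(* The rows of [L] are a basis of the orthogonal complement of [v], and [pinvmx L] reads off
   coordinates in it. *)
move=> Qv; set L := row_base (kermx (B *m v^T)).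
have LB : L *m B *m v^T = 0.
  have : (L <= kermx (B *m v^T))%MS by rewrite eq_row_base.
  by move/sub_kermxP; rewrite mulmxA.
have LL : L *m pinvmx L = 1%:M by rewrite mulmxVp // row_base_free.
have Lw w : ip B w v = 0 -> w *m pinvmx L *m L = w.
  move=> wv; apply: mulmxKpV; rewrite eq_row_base; apply/sub_kermxP.
  by rewrite mulmxA ip_mxE wv; apply/matrixP => i j; rewrite !mxE mul0rn.
have Lv y : ip B (y *m L) v = 0.
  by rewrite /ip -(mulmxA y) -(mulmxA y) LB mulmx0 mxE.
have vL y : ip B v (y *m L) = 0 by rewrite ipC.
have Cid (W : normedModType R) U : Cinfty U (@id W) by apply/CinftyP => k; exact: Cn_id.
set l := \rank _ in L LB LL Lw Lv vL *.
pose s (y : 'rV[R]_l) : R^o := 1 + (-1) * ip B (y *m L) (y *m L).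
have Cmul U : Cinfty U (fun y : 'rV[R]_l => y *m L).
  by apply: Cinfty_linear => // a y z; rewrite mulmxDl -scalemxAl.
have Cs : Cinfty setT s.
  apply: Cinfty_add; [exact: openT|exact: Cinfty_cst|].
  apply: (Cinfty_scale (c := fun=> -1)); [exact: openT|exact: Cinfty_cst|].
  by apply: Cinfty_ip; [exact: openT|exact: Cmul|exact: Cmul].
pose V := [set y : 'rV[R]_l | 0 < s y].
have oV : open V.
  by have := Cinfty_open_preimage openT Cs (@open_gt R 0); rewrite setTI.
pose chi (y : 'rV[R]_l) := (Num.sqrt (s y) : R^o) *: v + y *m L.
have chiv y : ip B (chi y) v = Num.sqrt (s y) by rewrite /chi ipDl Lv addr0 ipZl Qv mulr1.
have s0 : s 0 = 1 by rewrite /s mul0mx ip0l mulr0 addr0.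
exists l, V, chi, 0; split; last first.
- by rewrite /chi s0 sqrtr1 scale1r mul0mx addr0.
- by rewrite /V /= s0.
pose Om := [set z : 'rV[R]_n | 0 < ip B z v].
have Cipv : Cinfty setT (fun z : 'rV[R]_n => ip B z v : R^o).
  by apply: Cinfty_ip; [exact: openT|exact: Cid|exact: Cinfty_cst].
have oOm : open Om.
  by have := Cinfty_open_preimage openT Cipv (@open_gt R 0); rewrite setTI.
pose G (z : 'rV[R]_n) : 'rV[R]_l := (z + - ip B z v *: v) *m pinvmx L.
apply/local_parametrizationP; split=> //.
- apply: Cinfty_add => //; apply: Cinfty_scale => //; last exact: Cinfty_cst.
  by apply: Cinfty_sqrt => //; exact: Cinfty_sub Cs.
- move=> y Vy; rewrite /quadric /= /chi ipDl !ipDr ipZZ !(ipZl, ipZr) Qv vL Lv.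
  by rewrite !mulr0 addr0 add0r mulr1 sqr_sqrtr ?ltW // /s mulN1r subrK.
move=> y Vy; exists Om, G; split; first by rewrite /Om /= chiv sqrtr_gt0.
split=> //.
- apply: Cinfty_linear => //; move=> a x z.
  by rewrite /G ipDl ipZl scalemxAl -mulmxDl; congr (_ *m _);
     rewrite scalerDr opprD scalerDl scalerA mulrN addrACA.
- move=> z zv Qz.
  pose w := z + - ip B z v *: v.
  have wv : ip B w v = 0 by rewrite /w ipDl ipZl Qv mulr1 subrr.
  have GL : G z *m L = w by exact: Lw.
  have sG : s (G z) = ip B z v ^+ 2.
    rewrite /s GL /w ipDl !ipDr !(ipZl, ipZr) Qv Qz (ipC v z) //.
    set a := ip B z v; by ring.
  split; first by rewrite /V /= sG exprn_gt0.
  rewrite /chi sG GL sqrtr_sqr gtr0_norm // /w addrCA -scalerDl subrr scale0r.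
  by rewrite addr0.
- move=> u Vu _; rewrite /G chiv /chi addrAC -scalerDl subrr scale0r add0r.
  by rewrite -mulmxA LL mulmx1.
Qed.

Lemma nondegenerate_target_quadric :
  nondegenerate_target B (quadric B) (fun v w => ip B v w = 0).
Proof.
apply: nondegenerate_targetI.
- exact: exists_quadric_chart.
- by move=> l V chi y x Lchi Vy; exact: param_orthogonal Lchi Vy.
- move=> v w Qv vw; exists [set z | 0 < ip B z z], punit; split.
  + by split; [exact: open_spacelike|rewrite /= Qv].
  + exact: Cinfty_punit.
  + exact: quadric_punit.
  + by have := punitZ ltr01 Qv; rewrite scale1r.
  + exact: jac_punit.
- move=> v w Qv vw H; apply: ip_nondegenerate => z.
  (* Since <v, v> = 1, removing the component along [v] carries any [z] into the complement of [v];
     hence [w] is orthogonal to every [z]. *)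
  have := H (z - ip B v z *: v).
  rewrite ipDr ipNr ipZr Qv mulr1 subrr => /(_ erefl).
  by rewrite ipDr ipNr ipZr (ipC w v) // vw mulr0 subr0.
Qed.

End targets.

(** * Cones over submanifolds of the quadric *)

(** The inverse of [Y *m g *m Y^T] is [K^T *m invmx g *m K]; cyclicity of the trace does the
    rest. *)
Lemma mxtrace_congruence (F : comUnitRingType) k j (g H : 'M[F]_k)
    (Y : 'M[F]_(j, k)) (K : 'M[F]_(k, j)) :
  g \in unitmx -> Y *m K = 1%:M -> K *m Y = 1%:M ->
  \tr (invmx (Y *m g *m Y^T) *m (Y *m H *m Y^T)^T) = \tr (invmx g *m H^T).
Proof.
move=> gU YK KY.
have E : (Y *m g *m Y^T) *m (K^T *m invmx g *m K) = 1%:M.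
  rewrite !mulmxA -(mulmxA _ Y^T) -trmx_mul KY trmx1 mulmx1.
  by rewrite -(mulmxA Y) mulmxV // mulmx1.
have [U _] := mulmx1_unit E.
have -> : invmx (Y *m g *m Y^T) = K^T *m invmx g *m K.
  by rewrite -[RHS](mulKmx U) E mulmx1.
rewrite !trmx_mul trmxK !mulmxA -(mulmxA _ K) KY mulmx1 mxtrace_mulC.
by rewrite !mulmxA -trmx_mul KY trmx1 mul1mx.
Qed.

(** * Invariance of the normal trace under change of chart *)

Section trace_hess.
Context {R : realType} {n : nat} (B : 'M[R]_n).

Lemma ip_suml I (r : seq I) (P : pred I) (F : I -> 'rV[R]_n) w :
  ip B (\sum_(i <- r | P i) F i) w = \sum_(i <- r | P i) ip B (F i) w.
Proof.
elim/big_rec2: _ => [|i y z _ <-]; first by rewrite ip0l.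
by rewrite ipDl.
Qed.

(** For [w] normal to the image this is the second fundamental form in the direction [w]. *)
Definition hess_form k (phi : 'rV[R]_k -> 'rV[R]_n) u (w : 'rV[R]_n) : 'M[R]_k :=
  \matrix_(a, b) ip B (hess phi u a b) w.

Lemma ip_trace_hess k (phi : 'rV[R]_k -> 'rV[R]_n) u w :
  ip B (trace_hess B phi u) w =
  \tr (invmx (induced_metric B phi u) *m (hess_form phi u w)^T).
Proof.
rewrite ip_suml; apply: eq_bigr => a _; rewrite ip_suml mxE.
by apply: eq_bigr => b _; rewrite ipZl !mxE.
Qed.

Lemma eq_hess_form k (U : set 'rV[R]_k) (f g : 'rV[R]_k -> 'rV[R]_n) u w :
  open U -> (forall x, U x -> f x = g x) -> U u ->
  hess_form f u w = hess_form g u w.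
Proof.
move=> oU fg Uu; apply: eq_mx => a b.
exact: (congr1 (fun v => ip B v w) (eq_hess a b oU fg Uu)).
Qed.

(** The term with second derivatives of [y] is tangent while [w] is normal, so the form transforms
    as a tensor. *)
Lemma hess_form_comp k j (U : set 'rV[R]_j) (V : set 'rV[R]_k)
    (phi : 'rV[R]_k -> 'rV[R]_n) (y : 'rV[R]_j -> 'rV[R]_k) u w :
  open U -> Cinfty U y -> Cinfty V phi -> (forall x, U x -> V (y x)) -> U u ->
  jac phi (y u) *m B *m w^T = 0 ->
  hess_form (fun x => phi (y x)) u w =
  jac y u *m hess_form phi (y u) w *m (jac y u)^T.
Proof.
move=> oU Cy Cphi yV Uu Jw; apply/matrixP => a b.
have X0 (x : 'rV[R]_k) : ip B (x *m jac phi (y u)) w = 0.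
  by rewrite /ip -!mulmxA (mulmxA (jac phi _)) Jw mulmx0 mxE.
rewrite mxE (hess_comp _ _ oU Cy Cphi yV Uu) ipDl X0 addr0.
rewrite [RHS]mxE ip_suml; apply: eq_bigr => c _.
rewrite ip_suml [X in _ = X * _]mxE [X in _ = _ * X]mxE mulrC mulr_sumr.
apply: eq_bigr => d _; rewrite ipZl mulrA; congr (_ * _); last by rewrite mxE.
Qed.

(** Factoring each chart through the other gives the matrices of [mxtrace_congruence]; they are
    mutually inverse because the Jacobian of a chart has a right inverse. *)
Lemma trace_hess_transfer (M : set 'rV[R]_n) k (U : set 'rV[R]_k) phi u
    j (U' : set 'rV[R]_j) psi u' w :
  local_parametrization M U phi -> local_parametrization M U' psi ->
  U u -> U' u' -> psi u' = phi u -> induced_metric B phi u \in unitmx ->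
  jac phi u *m B *m w^T = 0 ->
  ip B (trace_hess B psi u') w = ip B (trace_hess B phi u) w.
Proof.
move=> Lphi Lpsi Uu Uu' E gU Jw.
have [oU Cphi UM _] := (local_parametrizationP _ _ _).1 Lphi.
have [oU' Cpsi UM' _] := (local_parametrizationP _ _ _).1 Lpsi.
have [ O [y [oO Ou' sO Cy [yU yE yu']]]] := param_factor Lphi Uu oU' Cpsi Uu' UM' E.
have dy := Cinfty_differentiable Cy Ou'.
have dphi : differentiable phi (y u').
  by rewrite yu'; exact: Cinfty_differentiable Cphi Uu.
have JY : jac psi u' = jac y u' *m jac phi u.
  by rewrite -(eq_jac oO yE Ou') (jac_comp dy dphi) yu'.
have [K JK] := param_jac_factor Lpsi Uu' oU Cphi Uu UM (esym E).
have [P phiP] := param_jac_inv Lphi Uu.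
have [Q psiQ] := param_jac_inv Lpsi Uu'.
have KY : K *m jac y u' = 1%:M.
  by rewrite -[LHS]mulmx1 -phiP !mulmxA -(mulmxA K) -JY -JK.
have YK : jac y u' *m K = 1%:M.
  by rewrite -[LHS]mulmx1 -psiQ !mulmxA -(mulmxA (jac y _)) -JK -JY.
rewrite !ip_trace_hess.
have -> : induced_metric B psi u' = jac y u' *m induced_metric B phi u *m (jac y u')^T.
  by rewrite !induced_metricE JY trmx_mul !mulmxA.
rewrite -(eq_hess_form w oO yE Ou').
have Jw' : jac phi (y u') *m B *m w^T = 0 by rewrite yu'.
rewrite (hess_form_comp oO Cy Cphi yU Ou' Jw') yu'.
exact: mxtrace_congruence gU YK KY.
Qed.

End trace_hess.

(** * Polar charts on a cone *)

Section cone_param.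
Context {R : realType} {n : nat} (B : 'M[R]_n).
Hypotheses (sB : B^T = B) (uB : B \in unitmx).

Definition cone_over (S : set 'rV[R]_n) : set 'rV[R]_n :=
  [set z | exists r s, [/\ 0 < r, S s & z = r *: s]].

(** Polar coordinates are stored in a row of length [1 + k]: the radius, then a point of the chart
    of the base. *)
Definition cone_radius k (z : 'rV[R]_(1 + k)) : R^o := lsubmx z 0 0.

Lemma cone_radius_is_linear k : linear (@cone_radius k).
Proof. by move=> a x y; rewrite /cone_radius !mxE. Qed.

Lemma rsubmx_is_linear k : linear (@rsubmx R 1 1 k).
Proof. by move=> a x y; rewrite !linearE. Qed.

Definition cone_dom k (U : set 'rV[R]_k) : set 'rV[R]_(1 + k) :=
  [set z | 0 < cone_radius z /\ U (rsubmx z)].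

Definition cone_param k (phi : 'rV[R]_k -> 'rV[R]_n) (z : 'rV[R]_(1 + k)) :
  'rV[R]_n := cone_radius z *: phi (rsubmx z).

Lemma open_cone_dom k (U : set 'rV[R]_k) : open U -> open (cone_dom U).
Proof.
move=> oU.
have C1 := Cinfty_linear (U := setT) (has_coordinates_rV (1 + k)) (@cone_radius_is_linear k).
have C2 := Cinfty_linear (U := setT) (has_coordinates_rV (1 + k)) (@rsubmx_is_linear k).
have o1 := Cinfty_open_preimage openT C1 (@open_gt R 0).
have o2 := Cinfty_open_preimage openT C2 oU.
by move: (openI o1 o2); rewrite !setTI.
Qed.

Lemma Cinfty_cone_param k (U : set 'rV[R]_k) phi : open U -> Cinfty U phi ->
  Cinfty (cone_dom U) (cone_param phi).
Proof.
move=> oU Cphi; have oD := open_cone_dom oU.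
have C1 := Cinfty_linear (U := cone_dom U) (has_coordinates_rV (1 + k)) (@cone_radius_is_linear k).
have C2 := Cinfty_linear (U := cone_dom U) (has_coordinates_rV (1 + k)) (@rsubmx_is_linear k).
apply: (Cinfty_scale oD C1).
by apply: (Cinfty_comp (has_coordinates_rV k) oD _ C2 Cphi) => z [].
Qed.

Lemma derive_cone_param k (U : set 'rV[R]_k) phi z v : Cinfty U phi ->
  U (rsubmx z) ->
  'D_v (cone_param phi) z =
  cone_radius z *: 'D_(rsubmx v) phi (rsubmx z) + cone_radius v *: phi (rsubmx z).
Proof.
move=> Cphi Uz.
have dr : differentiable (@cone_radius k) z.
  apply: (Cinfty_differentiable (U := setT)) => //.
  exact: Cinfty_linear (has_coordinates_rV (1 + k)) (@cone_radius_is_linear k).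
have ds : differentiable (@rsubmx R 1 1 k) z.
  apply: (Cinfty_differentiable (U := setT)) => //.
  exact: Cinfty_linear (has_coordinates_rV (1 + k)) (@rsubmx_is_linear k).
have [dp Dp] := derive_comp v ds (Cinfty_differentiable Cphi Uz).
have [_ D] := derive_scale v dr dp.
rewrite /cone_param D Dp.
rewrite (derive_linear _ _ (has_coordinates_rV (1 + k)) (@rsubmx_is_linear k)).
by rewrite (derive_linear _ _ (has_coordinates_rV (1 + k)) (@cone_radius_is_linear k)).
Qed.

Lemma jac_cone_param k (U : set 'rV[R]_k) phi z : Cinfty U phi ->
  U (rsubmx z) ->
  jac (cone_param phi) z = col_mx (phi (rsubmx z)) (cone_radius z *: jac phi (rsubmx z)).
Proof.
move=> Cphi Uz; apply/row_matrixP => a.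
rewrite row_jac (derive_cone_param _ Cphi Uz).
rewrite -(mul_jac _ (Cinfty_differentiable Cphi Uz)).
rewrite [RHS]rowE -[in RHS](hsubmxK (delta_mx 0 a)) mul_row_col addrC.
rewrite -scalemxAr; congr (_ + _).
rewrite /cone_radius; move: (lsubmx _) => t.
by rewrite [in RHS](mx11_scalar t) mul_scalar_mx.
Qed.

Section over_quadric.
Variable S : set 'rV[R]_n.
Hypothesis SQ : S `<=` quadric B.

(** [pnorm] is 1 on the quadric and [r] on [r *: s], which forces [r = 1]. *)
Lemma cone_over_quadric : cone_over S `&` quadric B = S.
Proof.
apply/seteqP; split=> [z [[r [s [r0 Ss ->]]] Qz]|s Ss].
  have : pnorm B (r *: s) = 1 by rewrite /pnorm Qz sqrtr1.
  by rewrite pnormZ //; [move=> ->; rewrite scale1r|exact: SQ].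
by split; [exists 1, s; rewrite scale1r|exact: SQ].
Qed.

Lemma cone_over_spacelike z : cone_over S z -> 0 < ip B z z.
Proof.
by move=> [r [s [r0 /SQ Qs ->]]]; rewrite ipZZ Qs mulr1 exprn_gt0.
Qed.

(** The inverse of a polar chart is x -> ([pnorm B x], [G (punit B x)]), on the spacelike vectors
    whose retraction lies in the domain of [G]. *)
Lemma local_parametrization_cone k (U : set 'rV[R]_k) phi :
  local_parametrization S U phi ->
  local_parametrization (cone_over S) (cone_dom U) (cone_param phi).
Proof.
move=> /local_parametrizationP[oU Cphi US inv].
apply/local_parametrizationP; split.
- exact: open_cone_dom.
- exact: Cinfty_cone_param.
- by move=> z [z0 Uz]; exists (cone_radius z), (phi (rsubmx z)); split=> //; exact: US.
move=> z [z0 Uz]; have [Om [G [Omz [oOm CG GM GK]]]] := inv _ Uz.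
pose Om1 := [set z | 0 < ip B z z] `&` punit B @^-1` Om.
have oOm1 : open Om1.
  by apply: Cinfty_open_preimage => //; [exact: open_spacelike|exact: Cinfty_punit].
exists Om1, (fun x => row_mx ((pnorm B x)%:M : 'M[R]_1) (G (punit B x))); split.
  split; first by apply: cone_over_spacelike; exists (cone_radius z), (phi (rsubmx z));
    split=> //; exact: US.
  by rewrite /preimage /= punitZ //; exact/SQ/US.
have radE (r : R) (x : 'rV[R]_k) : cone_radius (row_mx (r%:M : 'M[R]_1) x) = r.
  by rewrite /cone_radius row_mxKl mxE eqxx mulr1n.
split=> //.
(* A scaled constant row plus a linear image of [G (punit B x)]: the closure rules for smooth maps
   apply to this form. *)
- have -> : (fun x => row_mx ((pnorm B x)%:M : 'M[R]_1) (G (punit B x))) =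
     (fun x => pnorm B x *: (row_mx 1%:M 0 : 'rV[R]_(1 + k)) + row_mx 0 (G (punit B x))).
    apply/funext => x; rewrite scale_row_mx add_row_mx scaler0 add0r addr0.
    by rewrite scalemx1.
  have Cp : Cinfty Om1 (pnorm B) by apply: Cinfty_sub (Cinfty_pnorm (B := B)) => x [].
  apply: Cinfty_add => //.
    by apply: Cinfty_scale => //; exact: Cinfty_cst.
  have Cu : Cinfty Om1 (punit B) by apply: Cinfty_sub (Cinfty_punit (B := B)) => x [].
  have CGu : Cinfty Om1 (fun x => G (punit B x)).
    by apply: (Cinfty_comp (has_coordinates_rV n) oOm1 _ Cu CG) => x [].
  have lr : linear (fun y : 'rV[R]_k => row_mx (0 : 'M[R]_1) y).
    by move=> a x y; rewrite scale_row_mx add_row_mx scaler0 addr0.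
  have Cr := Cinfty_linear (U := setT) (has_coordinates_rV k) lr.
  exact: (Cinfty_comp (has_coordinates_rV k) oOm1 (fun _ _ => I) CGu Cr).
- move=> x [x0 Omx] [r [s [r0 Ss xE]]].
  have Qs := SQ Ss.
  have pE : punit B x = s by rewrite xE punitZ.
  have nE : pnorm B x = r by rewrite xE pnormZ.
  have Oms : Om s by rewrite -pE.
  have [UG GE] := GM _ Oms Ss.
  rewrite pE nE /cone_dom /cone_param /= radE row_mxKr; split=> //.
  by rewrite GE xE.
- move=> x [x0 Ux] [_ Omx].
  have Qx := SQ (US _ Ux).
  move: Omx; rewrite /preimage /= /cone_param punitZ // pnormZ // => Omx.
  rewrite GK // -[RHS]hsubmxK; congr row_mx.
  by apply/matrixP => i j; rewrite !ord1 mxE eqxx mulr1n.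
Qed.

Lemma induced_metric_cone k (U : set 'rV[R]_k) phi z :
  local_parametrization S U phi -> cone_dom U z ->
  induced_metric B (cone_param phi) z =
  block_mx 1%:M 0 0 (cone_radius z ^+ 2 *: induced_metric B phi (rsubmx z)).
Proof.
move=> Lphi [z0 Uz].
have [oU Cphi US _] := (local_parametrizationP _ _ _).1 Lphi.
have pJ : phi (rsubmx z) *m B *m (jac phi (rsubmx z))^T = 0.
  apply/rowP => i; rewrite [RHS]mxE mul_form_jac -row_jac rowE.
  exact: (param_orthogonal sB _ SQ Lphi Uz).
have Jp : jac phi (rsubmx z) *m B *m (phi (rsubmx z))^T = 0.
  by apply: trmx_inj; rewrite !trmx_mul trmxK sB trmx0 mulmxA.
rewrite induced_metricE (jac_cone_param Cphi Uz) tr_col_mx mul_col_mx mul_col_row.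
have trZ : (cone_radius z *: jac phi (rsubmx z))^T = cone_radius z *: (jac phi (rsubmx z))^T.
  exact: linearZ.
rewrite trZ -!scalemxAl -!scalemxAr pJ Jp !scaler0.
by rewrite ip_mxE (SQ (US _ Uz)) scalerA -expr2 -induced_metricE.
Qed.

(** The direction [rsubmx (delta_mx 0 a)] is 0 for the radial index and a basis vector otherwise, so
    one formula covers all pairs of indices. The row [x] collects the mixed radial terms, which are
    tangent to [S]. *)
Lemma hess_cone_param k (U : set 'rV[R]_k) phi z a b :
  open U -> Cinfty U phi -> cone_dom U z ->
  exists x, hess (cone_param phi) z a b =
    cone_radius z *: 'D_(rsubmx (delta_mx 0 a))
      (fun w => 'D_(rsubmx (delta_mx 0 b)) phi w) (rsubmx z)
    + x *m jac phi (rsubmx z).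
Proof.
move=> oU Cphi [z0 Uz].
set va := rsubmx (delta_mx 0 a); set vb := rsubmx (delta_mx 0 b).
have oD := open_cone_dom oU.
have Cb : Cinfty U (fun w => 'D_vb phi w) by exact: Cinfty_derive.
have Ca : Cinfty setT (@rsubmx R 1 1 k).
  exact: Cinfty_linear (has_coordinates_rV (1 + k)) (@rsubmx_is_linear k).
exists (cone_radius (delta_mx 0 a) *: vb + cone_radius (delta_mx 0 b) *: va).
rewrite /hess (near_eq_derive (g := fun w => cone_param (fun u => 'D_vb phi u) w
    + cone_radius (delta_mx 0 b) *: phi (rsubmx w))); last first.
  apply: filterS (open_nbhs_nbhs (conj oD (conj z0 Uz))) => w [w0 Uw].
  by rewrite (derive_cone_param _ Cphi Uw).
have d1 : differentiable (cone_param (fun u => 'D_vb phi u)) z.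
  apply: (Cinfty_differentiable (U := cone_dom U)) => //.
  exact: Cinfty_cone_param.
have ds : differentiable (@rsubmx R 1 1 k) z by exact: Cinfty_differentiable Ca I.
have [d2 D2] := derive_comp (delta_mx 0 a) ds (Cinfty_differentiable Cphi Uz).
have d3 : derivable (fun w => phi (rsubmx w)) z (delta_mx 0 a) by exact: diff_derivable.
have -> : (fun w => cone_param (fun u => 'D_vb phi u) w
    + cone_radius (delta_mx 0 b) *: phi (rsubmx w)) = cone_param (fun u => 'D_vb phi u) +
    (cone_radius (delta_mx 0 b) \*: (fun w => phi (rsubmx w))) by [].
rewrite deriveD; [|exact: diff_derivable|exact: derivableZ].
rewrite deriveZ // D2 (derive_cone_param _ Cb Uz).
rewrite (derive_linear _ _ (has_coordinates_rV (1 + k)) (@rsubmx_is_linear k)).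
rewrite mulmxDl -!scalemxAl !(mul_jac _ (Cinfty_differentiable Cphi Uz)).
by rewrite -addrA.
Qed.

(** The nonradial block of the inverse metric carries r^-2 and the second derivatives carry r,
    whence r^-1. The radial row and column vanish as derivatives along the zero direction. *)
Lemma trace_hess_cone k (U : set 'rV[R]_k) phi z w :
  local_parametrization S U phi -> cone_dom U z ->
  induced_metric B phi (rsubmx z) \in unitmx ->
  jac phi (rsubmx z) *m B *m w^T = 0 ->
  ip B (trace_hess B (cone_param phi) z) w =
  (cone_radius z)^-1 * ip B (trace_hess B phi (rsubmx z)) w.
Proof.
move=> Lphi Dz gU Jw.
have [oU Cphi US _] := (local_parametrizationP _ _ _).1 Lphi.
have [z0 Uz] := Dz.
have zn : cone_radius z != 0 by rewrite gt_eqF.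
have hE a b : ip B (hess (cone_param phi) z a b) w = cone_radius z *
    ip B ('D_(rsubmx (delta_mx 0 a))
      (fun w => 'D_(rsubmx (delta_mx 0 b)) phi w) (rsubmx z)) w.
  have [x ->] := hess_cone_param a b oU Cphi Dz.
  rewrite ipDl ipZl; rewrite [X in _ + X](_ : _ = 0) ?addr0 //.
  by rewrite /ip -!mulmxA (mulmxA (jac _ _)) Jw mulmx0 mxE.
have r0 : rsubmx (delta_mx 0 (lshift k 0) : 'rV[R]_(1 + k)) = 0.
  by apply/rowP => i; rewrite !mxE eq_rlshift andbF.
have rr a : rsubmx (delta_mx 0 (rshift 1 a) : 'rV[R]_(1 + k)) = delta_mx 0 a.
  by apply/rowP => i; rewrite !mxE eq_rshift.
have E : (hess_form B (cone_param phi) z w)^T =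
    block_mx 0 0 0 (cone_radius z *: (hess_form B phi (rsubmx z) w)^T).
  have D0 (v : 'rV[R]_k) : 'D_v (fun w => 'D_0 phi w) (rsubmx z) = 0.
    have -> : (fun w => 'D_0 phi w) = cst 0 by apply/funext => x; rewrite derive0.
    exact: derive_cst.
  apply/matrixP => a b; rewrite mxE mxE hE.
  case: (split_ordP a) => a' ->; case: (split_ordP b) => b' ->;
    rewrite ?ord1 ?r0 ?rr ?derive0 ?D0 ?ip0l ?mulr0.
  - by rewrite block_mxEul mxE.
  - by rewrite block_mxEur mxE.
  - by rewrite block_mxEdl mxE.
  - by rewrite block_mxEdr !mxE.
rewrite !ip_trace_hess E (induced_metric_cone Lphi Dz).
have uG : cone_radius z ^+ 2 *: induced_metric B phi (rsubmx z) \in unitmx.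
  by rewrite unitmxZ // unitfE expf_neq0.
rewrite invmx_block_diag; last by rewrite unitmxE det_ublock unitrM -!unitmxE unitmx1.
rewrite mulmx_block !(mulmx0, mul0mx, addr0, add0r) mxtrace_block mxtrace0 add0r.
rewrite invmxZ // -scalemxAl -scalemxAr scalerA mxtraceZ; congr (_ * _).
by rewrite expr2 invfM -mulrA mulVf // mulr1.
Qed.

End over_quadric.
End cone_param.

(** * Homogeneity of the quadric *)

Section isometries.
Context {R : realType} {n : nat} (B : 'M[R]_n).
Hypothesis sB : B^T = B.

Definition reflection (d : 'rV[R]_n) : 'M[R]_n :=
  1%:M - (2 / ip B d d) *: (B *m d^T *m d).

Lemma mul_reflection d x : x *m reflection d = x - (2 * ip B x d / ip B d d) *: d.
Proof.
rewrite /reflection mulmxBr mulmx1 -scalemxAr !mulmxA ip_mxE mul_scalar_mx scalerA.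
by rewrite mulrAC.
Qed.

Lemma isometry_reflection d : ip B d d != 0 -> isometries B (reflection d).
Proof.
move=> d0; rewrite /isometries /= /reflection; set c := 2 / _.
have trZ : (1%:M - c *: (B *m d^T *m d))^T = 1%:M - c *: (d^T *m d *m B).
  by rewrite linearB /= trmx1 linearZ /= !trmx_mul trmxK sB mulmxA.
rewrite trZ mulmxBl mul1mx mulmxBr mulmx1 mulmxBl -!scalemxAl -!scalemxAr.
rewrite !mulmxA -(mulmxA _ d) -(mulmxA _ (d *m B)) ip_mxE.
rewrite (_ : _ *m (ip B d d)%:M = ip B d d *: (B *m d^T)); last by rewrite mul_mx_scalar.
rewrite -!scalemxAl !scalerA.
have -> : c * (c * ip B d d) = c + c by rewrite /c; field.
by rewrite !mulmxA scalerDl opprB addrK subrK.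
Qed.

(** If [v - w] is not null, the reflection in it exchanges [v] and [w]. Otherwise <v, w> = 1, so <v
    + w, v + w> = 4, and minus the reflection in [v + w] sends [v] to [w]. *)
Lemma isometry_transitive v w : quadric B v -> quadric B w ->
  exists2 A, isometries B A & v *m A = w.
Proof.
move=> Qv Qw; rewrite /quadric /= in Qv Qw.
have nsub : ip B (v - w) (v - w) = 2 * (1 - ip B v w).
  by rewrite ipDl !ipDr !ipNl !ipNr Qv Qw (ipC w v) //; ring.
have nadd : ip B (v + w) (v + w) = 2 * (1 + ip B v w).
  by rewrite ipDl !ipDr Qv Qw (ipC w v) //; ring.
have vsub : ip B v (v - w) = 1 - ip B v w by rewrite ipDr ipNr Qv.
have vadd : ip B v (v + w) = 1 + ip B v w by rewrite ipDr Qv.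
case: (eqVneq (ip B (v - w) (v - w)) 0) => d0; last first.
  exists (reflection (v - w)); first exact: isometry_reflection.
  by rewrite mul_reflection vsub -nsub divff // scale1r opprB addrCA subrr addr0.
have d1 : ip B (v + w) (v + w) != 0.
  rewrite nadd; move: d0; rewrite nsub => /eqP; rewrite mulf_eq0 pnatr_eq0 /=.
  by rewrite subr_eq0 => /eqP <-; rewrite -mulr2n mulf_neq0 ?pnatr_eq0.
exists (- reflection (v + w)).
  rewrite /isometries /= linearN /= mulNmx mulmxN mulNmx opprK.
  exact: isometry_reflection.
rewrite mulmxN mul_reflection vadd -nadd divff // scale1r.
by rewrite opprB addrAC subrr add0r.
Qed.

Lemma orbit_isometries v : quadric B v ->
  [set v *m A | A in isometries B] = quadric B.
Proof.
move=> Qv; apply/seteqP; split=> [_ [A hA <-]|w Qw].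
  rewrite /quadric /= /ip trmx_mul !mulmxA -(mulmxA v) -(mulmxA v).
  by move: hA; rewrite /isometries /= => ->.
by have [A hA <-] := isometry_transitive Qv Qw; exists A.
Qed.

End isometries.

(** In the basis given by the rows of [M], which starts with [v], an isometry fixing [v] has first
    row (1, 0); preservation of the form then kills the rest of the first column. The map [h] takes
    the remaining diagonal block. *)
Lemma stabilizer_isometries (R : realType) (m : nat) (B M : 'M[R]_(1 + m))
    (E : 'M[R]_m) (v : 'rV[R]_(1 + m)) :
  M \in unitmx -> M *m B *m M^T = block_mx 1%:M 0 0 E ->
  row_mx 1%:M 0 *m M = v ->
  exists h : 'M[R]_(1 + m) -> 'M[R]_m,
    set_bij (stabilizer B v) (isometries E) h /\
    forall A C, stabilizer B v A -> stabilizer B v C ->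
      h (A *m C) = h A *m h C.
Proof.
move=> uM ME e0v.
have BE : B = invmx M *m block_mx 1%:M 0 0 E *m (invmx M)^T.
  rewrite -ME !mulmxA mulVmx // mul1mx -mulmxA -trmx_mul mulVmx //.
  by rewrite trmx1 mulmx1.
have MT : M^T *m (invmx M)^T = 1%:M by rewrite -trmx_mul mulVmx // trmx1.
have MT' : (invmx M)^T *m M^T = 1%:M by rewrite -trmx_mul mulmxV // trmx1.
have MC A : stabilizer B v A -> exists2 D, isometries E D &
    M *m A *m invmx M = block_mx 1%:M 0 0 D.
  move=> [hA vA]; rewrite /isometries /= in hA; rewrite /= in vA.
  pose D := M *m A *m invmx M.
  have DE : D *m block_mx 1%:M 0 0 E *m D^T = block_mx 1%:M 0 0 E.
    rewrite -ME /D !trmx_mul -!mulmxA (mulmxA (invmx M) M) mulVmx // mul1mx.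
    rewrite (mulmxA M^T) MT mul1mx.
    by rewrite (mulmxA A) (mulmxA (A *m B)) hA.
  have eD : row_mx 1%:M 0 *m D = row_mx (1%:M : 'M[R]_1) (0 : 'M[R]_(1, m)).
    by rewrite /D !mulmxA e0v vA -e0v mulmxK.
  move: eD; rewrite -{1}(submxK D) mul_row_block !mul1mx !mul0mx !addr0.
  move=> /eq_row_mx[ul ur].
  move: DE; rewrite -[D]submxK ul ur.
  rewrite tr_block_mx !mulmx_block !(trmx1, trmx0, mul1mx, mulmx1, mul0mx, mulmx0, addr0, add0r).
  move=> /eq_block_mx[_ _ dl DE]; exists (drsubmx D).
    by move: DE; rewrite dl mul0mx add0r.
  by rewrite -/D -[LHS]submxK ul ur dl.
exists (fun A => drsubmx (M *m A *m invmx M)); split; last first.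
  move=> A C hA hC; have [DA _ EA] := MC A hA; have [DC _ EC] := MC C hC.
  have -> : M *m (A *m C) *m invmx M = (M *m A *m invmx M) *m (M *m C *m invmx M).
    by rewrite !mulmxA mulmxKV.
  by rewrite EA EC mulmx_block !block_mxKdr mul0mx add0r.
split.
- by move=> A hA; have [D hD ->] := MC A hA; rewrite block_mxKdr.
- move=> A C /set_mem hA /set_mem hC; have [DA _ EA] := MC A hA; have [DC _ EC] := MC C hC.
  rewrite EA EC !block_mxKdr => E12.
  have E1 : M *m A *m invmx M = M *m C *m invmx M by rewrite EA EC E12.
  have := congr1 (fun X => invmx M *m (X *m M)) E1.
  by rewrite !mulmxKV // !mulKmx.
- move=> D hD; exists (invmx M *m block_mx 1%:M 0 0 D *m M); last first.
    by rewrite !mulmxA mulmxV // mul1mx mulmxK // block_mxKdr.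
  split=> /=.
    rewrite /isometries /= {1}BE !trmx_mul -!mulmxA.
    rewrite (mulmxA M (invmx M)) mulmxV // mul1mx.
    rewrite (mulmxA (invmx M)^T) MT' mul1mx.
    rewrite !mulmxA BE; congr (_ *m _); rewrite -!mulmxA; congr (_ *m _).
    rewrite tr_block_mx !mulmx_block !(trmx1, trmx0, mul1mx, mulmx1, mul0mx, mulmx0, addr0, add0r).
    by rewrite mulmxA; move: hD; rewrite /isometries /= => ->.
  rewrite -e0v !mulmxA mulmxK // mul_row_block.
  by rewrite !(mul1mx, mul0mx, mulmx0, addr0).
Qed.

Section signature.
Context {R : realType}.

Lemma std_form_sym p q : (std_form p q : 'M[R]_(p + q))^T = std_form p q.
Proof. by rewrite /std_form tr_block_mx !trmx0 trmx1 linearN /= trmx1. Qed.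

(** The sizes [p.+1 + q] and [1 + (p + q)] are convertible but their block splittings differ, so
    both sides are compared through an entrywise formula in the underlying natural numbers. *)
Lemma std_form_succ p q :
  std_form p.+1 q = block_mx 1%:M 0 0 (std_form p q) :> 'M[R]_(1 + (p + q)).
Proof.
have E p' (i j : 'I_(p' + q)) : (std_form p' q : 'M[R]_(p' + q)) i j =
    (i == j :> nat)%:R * (if (i < p')%N then 1 else -1).
  rewrite /std_form.
  case: (split_ordP i) => i' ->; case: (split_ordP j) => j' ->.
  - by rewrite block_mxEul mxE /= mulr1.
  - rewrite block_mxEur mxE /= (_ : (_ == _) = false) ?mul0r //.
    by apply/negbTE; rewrite neq_ltn ltn_addr.
  - rewrite block_mxEdl mxE /= (_ : (_ == _) = false) ?mul0r //.
    by apply/negbTE; rewrite neq_ltn orbC ltn_addr.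
  - rewrite block_mxEdr !mxE /= eqn_add2l.
    by rewrite mulrN1.
apply/matrixP => i j; rewrite (E p.+1).
case: (@split_ordP 1 (p + q) i) => i' ->; case: (@split_ordP 1 (p + q) j) => j' ->.
- by rewrite block_mxEul !ord1 mxE /= mulr1.
- by rewrite block_mxEur !ord1 mxE /= mul0r.
- by rewrite block_mxEdl !ord1 mxE /= mul0r.
- by rewrite block_mxEdr E.
Qed.

Lemma signature_sym p q (B : 'M[R]_(p + q)) : has_signature B -> B^T = B.
Proof.
move=> [P uP PE].
have BE : B = invmx P *m std_form p q *m (invmx P)^T.
  rewrite -PE !mulmxA mulVmx // mul1mx -mulmxA -trmx_mul mulVmx //.
  by rewrite trmx1 mulmx1.
by rewrite BE !trmx_mul trmxK std_form_sym mulmxA.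
Qed.

Lemma signature_unit p q (B : 'M[R]_(p + q)) : has_signature B -> B \in unitmx.
Proof.
move=> [P uP PE].
have E1 : (std_form p q : 'M[R]_(p + q)) \in unitmx.
  by rewrite unitmxE det_ublock det1 mul1r -unitmxE -scaleN1r unitmxZ ?unitrN1 ?unitmx1.
by move: E1; rewrite -PE !unitmx_mul => /andP[/andP[]].
Qed.

(** In an orthonormal basis the form is minus a sum of squares, which never equals 1. *)
Lemma quadric_signature0 q (B : 'M[R]_(0 + q)) v :
  has_signature B -> ~ quadric B v.
Proof.
move=> [P uP PE] Qv.
have := Qv; rewrite /quadric /= /ip -[v](mulmxKV uP); set x := v *m invmx P.
rewrite trmx_mul !mulmxA -(mulmxA x) -(mulmxA x) PE.
have -> : std_form 0 q = - 1%:M :> 'M[R]_(0 + q).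
  apply/matrixP => i j; rewrite /std_form.
  case: (split_ordP i) => [[]//|i' ->]; case: (split_ordP j) => [[]//|j' ->].
  by rewrite block_mxEdr !mxE eq_rshift.
rewrite mulmxN mulmx1 mulNmx mxE mxE => /eqP.
rewrite eqr_oppLR => /eqP xx.
have : 0 <= \sum_j x 0 j * x^T j 0.
  by apply: sumr_ge0 => j _; rewrite [x^T _ _]mxE -expr2 sqr_ge0.
by rewrite xx oppr_ge0 ler10.
Qed.

(** For positive [p] the first row of [P] lies on the quadric, and an isometry [A] moves it to [v];
    the rows of [P *m A] are then an orthonormal basis starting with [v]. *)
Lemma homogeneous_quadric p q (B : 'M[R]_(p + q)) :
  has_signature B -> quadric_is_homogeneous B.
Proof.
move=> hB v Qv; have sB := signature_sym hB.
split; first exact: orbit_isometries.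
case: p B hB v Qv sB => [|p] B hB v Qv sB.
  by have := quadric_signature0 hB Qv.
have [P uP PE] := hB.
rewrite std_form_succ in PE.
pose e : 'rV[R]_(1 + (p + q)) := row_mx 1%:M 0.
have Qe : quadric B (e *m P).
  rewrite /quadric /= /ip trmx_mul !mulmxA -(mulmxA e) -(mulmxA e) PE.
  rewrite mul_row_block tr_row_mx mul_row_col.
  by rewrite !(mul1mx, mul0mx, mulmx0, addr0, trmx1, mulmx1) mxE.
have [A hA eA] := isometry_transitive sB Qe Qv.
have uA : A \in unitmx.
  have := signature_unit hB; rewrite -[in X in X -> _]hA !unitmx_mul.
  by move=> /andP[/andP[]].
apply: (@stabilizer_isometries R (p + q) B (P *m A) (std_form p q) v).
- by rewrite unitmx_mul uP.
- rewrite trmx_mul -!mulmxA (mulmxA A) (mulmxA (A *m B)).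
  by move: hA; rewrite /isometries /= => ->; rewrite mulmxA.
- by rewrite mulmxA.
Qed.

End signature.

(** * The correspondence *)

Lemma Cinfty_pair (R : realType) (V W X : normedModType R) (U : set V)
    (f : V -> W) (g : V -> X) :
  has_coordinates W -> has_coordinates X -> open U ->
  Cinfty U f -> Cinfty U g -> Cinfty U (fun x => (f x, g x)).
Proof.
move=> cW cX oU Cf Cg.
have l1 : linear (fun w : W => (w, 0) : (W * X)%type).
  by move=> a x y; apply: injective_projections => //=; rewrite scaler0 addr0.
have l2 : linear (fun w : X => (0, w) : (W * X)%type).
  by move=> a x y; apply: injective_projections => //=; rewrite scaler0 addr0.
have C1 := Cinfty_comp cW oU (fun _ _ => I) Cf (Cinfty_linear (U := setT) cW l1).
have C2 := Cinfty_comp cX oU (fun _ _ => I) Cg (Cinfty_linear (U := setT) cX l2).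
have -> : (fun x => (f x, g x)) = (fun x => ((f x, 0) : (W * X)%type) + (0, g x)).
  by apply/funext => x; apply: injective_projections => /=; rewrite ?addr0 ?add0r.
exact: Cinfty_add.
Qed.

Section minimal_cones.
Context {R : realType} {n : nat} (B : 'M[R]_n).
Hypotheses (sB : B^T = B) (uB : B \in unitmx).
Implicit Types (S X : set 'rV[R]_n).

(** * What a cone presentation determines *)

Section presentation.
Variables (m : nat) (X : set 'rV[R]_n) (Sigma : set 'rV[R]_m)
  (i : 'rV[R]_m * R^o -> 'rV[R]_n).
Hypothesis pres : cone_presentation B X Sigma i.
Let S := [set i (x, 1) | x in Sigma].

(* Evaluate the metric [dr^2 + r^2 gS] on the radial vector; [gS] vanishes on
   the pair (0, 0) because the pulled back metric does. *)
Lemma presentation_quadric x : Sigma x -> quadric B (i (x, 1)).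
Proof.
case: pres => -[k subS] [_ _ _] homi [gS gSE] Sx.
have [U [phi [Lphi [u Uu ux]]]] := subS x Sx.
pose psi (z : 'rV[R]_k * R^o) := i (phi z.1, z.2).
have /= E0 := gSE _ _ _ Lphi u 1 Uu ltr01 0 0 0 0.
have /= E1 := gSE _ _ _ Lphi u 1 Uu ltr01 0 0 1 1.
have D0 : 'D_((0, 0) : 'rV[R]_k * R^o) psi (u, 1) = 0 by exact: derive0.
(* For small [h] the radius [h + 1] is positive, so homogeneity of [i] makes the difference quotient
   constant. *)
have D1 : 'D_((0, 1) : 'rV[R]_k * R^o) psi (u, 1) = i (x, 1).
  rewrite /derive; apply: cvg_lim => //; apply: cvg_near_cst.
  near=> h.
  have h0 : h != 0 by near: h; exact: nbhs_dnbhs_neq.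
  have h1 : 0 < h + 1.
    rewrite -ltrBlDr sub0r; suff : `|h| < 1 by rewrite ltr_norml => /andP[].
    by near: h; exact: dnbhs0_lt.
  rewrite /psi /= scaler0 add0r ux [h *: 1]mulr1 (homi x (h + 1) Sx h1).
  by rewrite scalerDl scale1r addrK scalerA mulVf // scale1r.
rewrite /quadric /= -D1 E1 -[RHS]addr0 mul1r; congr (_ + _).
move: E0; rewrite D0 ip0l mul0r add0r => <-.
by [].
Unshelve. all: by end_near. Qed.

Lemma presentation_cone_over : X = cone_over S.
Proof.
case: pres => _ [iX _ _] homi _; rewrite -iX; apply/seteqP; split.
  move=> _ [[x r] [/= Sx r0] <-]; exists r, (i (x, 1)); split=> //; last exact: homi.
  by exists x.
move=> _ [r [_ [r0 [x Sx <-] ->]]]; exists (x, r); last exact: homi.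
by split.
Qed.

Lemma presentation_sub : S `<=` quadric B.
Proof. by move=> _ [x Sx <-]; exact: presentation_quadric. Qed.

(** This makes the restriction well defined: the slice at radius 1 is the same for every
    presentation of [X]. *)
Lemma presentation_restrict : X `&` quadric B = S.
Proof.
by rewrite presentation_cone_over cone_over_quadric //; exact: presentation_sub.
Qed.

(** Charts of the slice are u -> [i (phi u, 1)]; their local inverses apply the smooth inverse of
    [i], keep the first component and apply [G]. *)
Lemma presentation_submanifold : submanifold S.
Proof.
case: pres => -[k subS] [iX si [j [jK sj]]] homi _; exists k.
move=> _ [x Sx <-]; have [U [phi [Lphi [u Uu ux]]]] := subS x Sx.
exists U, (fun u => i (phi u, 1)); split; last by exists u; rewrite // ux.
have [oU Cphi US inv] := (local_parametrizationP _ _ _).1 Lphi.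
have inA y : U y -> (Sigma `*` [set r : R^o | 0 < r]) (phi y, 1).
  by move=> Uy; split; [exact: US|exact: ltr01].
have inX y : U y -> X (i (phi y, 1)).
  by move=> Uy; rewrite -iX; exists (phi y, 1) => //; exact: inA.
have cP := has_coordinates_prod (has_coordinates_rV m) (@has_coordinates_R R).
have Cp : Cinfty U (fun y => (phi y, 1 : R^o)).
  by apply: Cinfty_pair => //; exact: Cinfty_cst.
apply/local_parametrizationP; split=> //.
- apply: Cinfty_locally => y Uy; have [ O [F [oO Oy CF FE]]] := si _ (inA y Uy).
  have oOU := Cinfty_open_preimage oU Cp oO.
  exists (U `&` (fun y => (phi y, 1 : R^o)) @^-1` O) => //.
  apply: (eq_Cinfty (f := fun y => F (phi y, 1))) => //.
    by move=> z [Uz Oz]; rewrite FE //; exact: inA.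
  have Cp' := Cinfty_sub (@subIsetl _ U _) Cp.
  by apply: (Cinfty_comp cP oOU _ (Cp' _) CF) => z [].
- by move=> y Uy; exists (phi y) => //; exact: US.
move=> y Uy; have [ O [F [oO Oy CF FE]]] := sj _ (inX y Uy).
have [Om [G [Omy [oOm CG GM GK]]]] := inv y Uy.
have lf : linear (@fst 'rV[R]_m R^o) by [].
have CF1 : Cinfty O (fun z => (F z).1).
  exact: (Cinfty_comp cP oO (fun _ _ => I) CF (Cinfty_linear (U := setT) cP lf)).
have oO' := Cinfty_open_preimage oO CF1 oOm.
have FE' y' : U y' -> O (i (phi y', 1)) -> F (i (phi y', 1)) = (phi y', 1).
  by move=> Uy' Oy'; rewrite FE ?jK //; [exact: inA|exact: inX].
exists (O `&` (fun z => (F z).1) @^-1` Om), (fun z => G (F z).1); split.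
  by split=> //; rewrite /preimage /= FE'.
split=> //.
- have CF1' := Cinfty_sub (@subIsetl _ O _) CF1.
  by apply: (Cinfty_comp (has_coordinates_rV m) oO' _ (CF1' _) CG) => z [].
- move=> z [Oz Omz] [y' Sy' y'z].
  have A1 : (Sigma `*` [set r : R^o | 0 < r]) (y', 1) by split=> //; exact: ltr01.
  have Xz : X z by rewrite -iX; exists (y', 1).
  have Fz : F z = (y', 1) by rewrite FE // -y'z jK.
  move: Omz; rewrite /preimage /= Fz => Omy'.
  by have [UG ->] := GM _ Omy' Sy'.
- move=> y' Uy' [Oy']; rewrite /preimage /= FE' // => Omy'.
  exact: GK.
Qed.

End presentation.

(** * From the cone over [S] back to [S] *)

Section restriction.
Variable S : set 'rV[R]_n.
Hypothesis SQ : S `<=` quadric B.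

Let unit_lift k (u : 'rV[R]_k) : 'rV[R]_(1 + k) := row_mx 1%:M u.

Let radius_unit_lift k (u : 'rV[R]_k) : cone_radius (unit_lift u) = 1.
Proof. by rewrite /cone_radius row_mxKl mxE eqxx. Qed.

Let rsubmx_unit_lift k (u : 'rV[R]_k) : rsubmx (unit_lift u) = u.
Proof. by rewrite row_mxKr. Qed.

Let cone_dom_unit_lift k (U : set 'rV[R]_k) u : U u -> cone_dom U (unit_lift u).
Proof. by move=> Uu; rewrite /cone_dom /= radius_unit_lift rsubmx_unit_lift. Qed.

(** At radius 1, a vector without radial component has the same square in the polar chart as in the
    chart of [S]. *)
Lemma positive_definite_restrict :
  positive_definite_metric B (cone_over S) -> positive_definite_metric B S.
Proof.
move=> pd k U phi Lphi u v Uu v0.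
have [_ Cphi _ _] := (local_parametrizationP _ _ _).1 Lphi.
have v1 : row_mx (0 : 'M[R]_1) v != 0.
  by apply: contraNneq v0 => /(congr1 rsubmx); rewrite row_mxKr => ->; rewrite linear0.
have := pd _ _ _ (local_parametrization_cone SQ Lphi) _ _ (cone_dom_unit_lift Uu) v1.
rewrite !ip_induced_metric (jac_cone_param (U := U) Cphi) rsubmx_unit_lift //.
by rewrite radius_unit_lift scale1r mul_row_col mul0mx add0r.
Qed.

(** The criterion for the cone is read at radius 1, where the factor of [trace_hess_cone] is 1;
    tangency of [w] to the quadric is exactly orthogonality to the radial row of the polar
    Jacobian. *)
Lemma harmonic_restrict :
  positive_definite_metric B (cone_over S) ->
  Defs.harmonic B (cone_over S) setT id -> Defs.harmonic B S (quadric B) id.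
Proof.
move=> pd har.
have ndS := positive_definite_nondegenerate (positive_definite_restrict pd).
have ndX := positive_definite_nondegenerate pd.
apply/(harmonic_idP sB (nondegenerate_target_quadric sB uB) ndS SQ).
move=> k U phi Lphi u w Uu pw Jw.
have [_ Cphi _ _] := (local_parametrizationP _ _ _).1 Lphi.
have LPhi := local_parametrization_cone SQ Lphi.
have H := (harmonic_idP sB (nondegenerate_target_setT uB) ndX (@subsetT _ _)).1 har
  _ _ _ LPhi _ w (cone_dom_unit_lift Uu) I.
have E : ip B (trace_hess B (cone_param phi) (unit_lift u)) w = ip B (trace_hess B phi u) w.
  rewrite (trace_hess_cone sB SQ Lphi (cone_dom_unit_lift Uu)) rsubmx_unit_lift //.
    by rewrite radius_unit_lift invr1 mul1r.
  exact: ndS Lphi _ Uu.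
rewrite -E; apply: H.
rewrite (jac_cone_param (U := U) Cphi) rsubmx_unit_lift // !mul_col_mx radius_unit_lift scale1r Jw.
by rewrite ip_mxE pw raddf0 col_mx0.
Qed.

End restriction.

(** * From [S] to the cone over [S] *)

Section extension.
Variable S : set 'rV[R]_n.
Hypothesis SQ : S `<=` quadric B.

Lemma exists_cone_chart d z : submanifold_dim d S -> cone_over S z ->
  exists (U : set 'rV[R]_d) phi x,
    [/\ local_parametrization S U phi, cone_dom U x & cone_param phi x = z].
Proof.
move=> subS [r [s [r0 Ss ->]]]; have [U [phi [Lphi [u Uu us]]]] := subS s Ss.
exists U, phi, (row_mx (r%:M : 'M[R]_1) u).
have rE : cone_radius (row_mx (r%:M : 'M[R]_1) u) = r.
  by rewrite /cone_radius row_mxKl mxE eqxx.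
by rewrite /cone_dom /cone_param /= rE row_mxKr us; split=> //.
Qed.

Lemma submanifold_cone_over : submanifold S -> submanifold (cone_over S).
Proof.
move=> [d subS]; exists (1 + d)%N => z Xz.
have [U [phi [x [Lphi Dx xz]]]] := exists_cone_chart subS Xz.
exists (cone_dom U), (cone_param phi); split; last by exists x.
exact (local_parametrization_cone SQ Lphi).
Qed.

(** [S] serves as its own model, with scaling as [i], the pair of [punit] and [pnorm] as inverse,
    and [B] itself as [gS] at every point. The cross terms vanish because positions are orthogonal
    to tangent vectors of [S]. *)
Lemma cone_presentation_cone_over : submanifold S ->
  cone_presentation B (cone_over S) S (fun z : 'rV[R]_n * R^o => z.2 *: z.1).
Proof.
move=> subS.
have ls : linear (@snd 'rV[R]_n R^o) by [].
have lf : linear (@fst 'rV[R]_n R^o) by [].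
have cN := has_coordinates_prod (has_coordinates_rV n) (@has_coordinates_R R).
split=> //.
- split.
  + apply/seteqP; split=> [_ [[s r] [/= Ss r0] <-]|_ [r [s [r0 Ss ->]]]].
      by exists r, s.
    by exists (s, r).
  + move=> x _; exists setT, (fun z : 'rV[R]_n * R^o => z.2 *: z.1); split=> //.
      exact: openT.
    apply: Cinfty_scale; first exact: openT.
      exact: Cinfty_linear cN ls.
    exact: Cinfty_linear cN lf.
  + exists (fun z => (punit B z, pnorm B z)); split.
      by move=> [s r] [/= Ss r0]; rewrite punitZ ?pnormZ //; exact: SQ.
    move=> z Xz; exists [set z | 0 < ip B z z], (fun z => (punit B z, pnorm B z)).
    split=> //; first exact: open_spacelike.
      exact: cone_over_spacelike Xz.
    apply: Cinfty_pair => //; first exact: open_spacelike.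
      exact: Cinfty_punit.
    exact: Cinfty_pnorm.
- by move=> x r _ _ /=; rewrite scale1r.
exists (fun _ v w => ip B v w) => k U phi Lphi /= u r Uu r0 v w s t.
have [oU Cphi US _] := (local_parametrizationP _ _ _).1 Lphi.
have dphi := Cinfty_differentiable Cphi Uu.
have ls' : linear (@snd 'rV[R]_k R^o) by [].
have lf' : linear (@fst 'rV[R]_k R^o) by [].
have cP := has_coordinates_prod (has_coordinates_rV k) (@has_coordinates_R R).
have D v' s' : 'D_((v', s') : 'rV[R]_k * R^o) (fun z : 'rV[R]_k * R^o => z.2 *: phi z.1) (u, r)
    = r *: 'D_v' phi u + s' *: phi u.
  have d2 : differentiable (@snd 'rV[R]_k R^o) (u, r).
    exact: (Cinfty_differentiable (Cinfty_linear (U := setT) cP ls')).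
  have d1 : differentiable (@fst 'rV[R]_k R^o) (u, r).
    exact: (Cinfty_differentiable (Cinfty_linear (U := setT) cP lf')).
  have [dp Dp] := derive_comp (f := phi) ((v', s') : 'rV[R]_k * R^o) d1 dphi.
  have [_ ->] := derive_scale ((v', s') : 'rV[R]_k * R^o) d2 dp.
  by rewrite Dp (derive_linear _ _ cP lf') (derive_linear _ _ cP ls').
have O x : ip B (phi u) ('D_x phi u) = 0.
  by rewrite -mul_jac //; exact: (param_orthogonal sB _ SQ Lphi Uu).
rewrite !D ipDl !ipDr !(ipZl, ipZr) O (ipC _ (phi u)) // O (SQ (US _ Uu)).
by rewrite !mulr0 !mulr1 addr0 add0r addrC mulrA expr2.
Qed.

(** The square of (a, b) is a^2 + r^2 g(b, b), and [a] is nonzero whenever [b] is 0. *)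
Lemma positive_definite_cone_param k (U : set 'rV[R]_k) phi z x :
  positive_definite_metric B S -> local_parametrization S U phi ->
  cone_dom U z -> x != 0 ->
  0 < ip (induced_metric B (cone_param phi) z) x x.
Proof.
move=> pd Lphi Dz x0; rewrite (induced_metric_cone sB SQ Lphi Dz).
have [z0 Uz] := Dz.
rewrite -[x]hsubmxK in x0 *.
move: (lsubmx x) (rsubmx x) x0 => a b ab0.
rewrite /ip mul_row_block tr_row_mx mul_row_col !(mulmx1, mulmx0, addr0, add0r) mxE.
rewrite -scalemxAr -scalemxAl [X in _ + X]mxE -/(ip _ b b).
have aa : (a *m a^T) 0 0 = a 0 0 ^+ 2.
  by rewrite mxE big_ord1 [a^T _ _]mxE expr2.
rewrite aa; case: (eqVneq b 0) => [b0|b0].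
  rewrite b0 ip0l mulr0 addr0 lt_neqAle sqr_ge0 andbT eq_sym expf_neq0 //.
  apply: contraNneq ab0 => a0; rewrite b0 (_ : a = 0) ?row_mx0 //.
  by apply/matrixP => i j; rewrite !ord1 a0 mxE.
apply: ltr_wpDl; first exact: sqr_ge0.
by apply: mulr_gt0; [exact: exprn_gt0|exact: pd Lphi _ _ Uz b0].
Qed.

(** Positivity is demanded in every chart of the cone. An arbitrary [psi] is factored through a
    polar chart, and injectivity of its Jacobian keeps nonzero vectors nonzero. *)
Lemma positive_definite_cone_over : submanifold S ->
  positive_definite_metric B S -> positive_definite_metric B (cone_over S).
Proof.
move=> [d subS] pd k U psi Lpsi u v Uu v0.
have [oU Cpsi UX _] := (local_parametrizationP _ _ _).1 Lpsi.
have [U' [phi [x [Lphi Dx xE]]]] := exists_cone_chart subS (UX _ Uu).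
have [Y JY] := param_jac_factor (local_parametrization_cone SQ Lphi) Dx oU Cpsi Uu UX (esym xE).
rewrite ip_induced_metric JY mulmxA -ip_induced_metric.
apply: (positive_definite_cone_param pd Lphi Dx).
apply: contraNneq v0 => vY; apply/eqP; apply: (param_jac_inj Lpsi Uu).
by rewrite JY mulmxA vY mul0mx.
Qed.

(** [trace_hess_transfer] replaces an arbitrary chart of the cone by a polar one, where the
    criterion for [S] can be applied. *)
Lemma harmonic_cone_over : submanifold S -> positive_definite_metric B S ->
  Defs.harmonic B S (quadric B) id -> Defs.harmonic B (cone_over S) setT id.
Proof.
move=> subS pd har.
have ndS := positive_definite_nondegenerate pd.
have pdX := positive_definite_cone_over subS pd.
have ndX := positive_definite_nondegenerate pdX.
apply/(harmonic_idP sB (nondegenerate_target_setT uB) ndX (@subsetT _ _)).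
move=> k U psi Lpsi u w Uu _ Jw.
have [d subSd] := subS.
have [oU Cpsi UX _] := (local_parametrizationP _ _ _).1 Lpsi.
have [U' [phi [x [Lphi Dx xE]]]] := exists_cone_chart subSd (UX _ Uu).
have [oU' Cphi US _] := (local_parametrizationP _ _ _).1 Lphi.
have [x0 Ux] := Dx.
have LPhi := local_parametrization_cone SQ Lphi.
have [oD CPhi DX _] := (local_parametrizationP _ _ _).1 LPhi.
have [K JK] := param_jac_factor Lpsi Uu oD CPhi Dx DX xE.
have JPw : jac (cone_param phi) x *m B *m w^T = 0.
  by rewrite JK -!mulmxA (mulmxA (jac psi u)) Jw mulmx0.
have gU : induced_metric B (cone_param phi) x \in unitmx by exact: ndX LPhi _ Dx.
rewrite (trace_hess_transfer LPhi Lpsi Dx Uu (esym xE) gU JPw).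
(* Orthogonality to the polar Jacobian splits by rows: the first gives tangency of [w] to the
   quadric, the others, after dividing by the radius, normality to [S]. *)
move: JPw; rewrite (jac_cone_param Cphi Ux) !mul_col_mx -col_mx0 => /eq_col_mx[pw].
rewrite -!scalemxAl => /eqP; rewrite scaler_eq0 gt_eqF //= => /eqP phiw.
have guU := ndS _ _ _ Lphi _ Ux.
rewrite (trace_hess_cone sB SQ Lphi Dx guU phiw).
have := (harmonic_idP sB (nondegenerate_target_quadric sB uB) ndS SQ).1 har
  _ _ _ Lphi _ w Ux.
by rewrite /ip pw mxE => /(_ erefl phiw) ->; rewrite mulr0.
Qed.

End extension.

(** The second conclusion recovers [X] from its slice, which yields injectivity of the
    restriction. *)
Lemma restrict_minimal_cone X : minimal_cones B X ->
  minimal_submanifolds_of_quadric B (X `&` quadric B) /\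
  X = cone_over (X `&` quadric B).
Proof.
move=> [[_ [m [Sigma [i pres]]]] pd [_ _ _ har]].
have E := presentation_restrict pres; have XE := presentation_cone_over pres.
have SQ := presentation_sub pres.
rewrite E -XE; split=> //; rewrite XE in pd har.
have pdS := positive_definite_restrict SQ pd.
split=> //; split=> //.
- exact: presentation_submanifold pres.
- exact: positive_definite_nondegenerate.
- exact: harmonic_restrict pd har.
Qed.

Lemma minimal_cone_over S : minimal_submanifolds_of_quadric B S ->
  minimal_cones B (cone_over S).
Proof.
move=> [pd [subS SQ _ har]].
have pdX := positive_definite_cone_over SQ subS pd.
have subX := submanifold_cone_over SQ subS.
split=> //.
  split=> //; exists n, S, (fun z : 'rV[R]_n * R^o => z.2 *: z.1).
  exact: cone_presentation_cone_over.
split=> //; first exact: positive_definite_nondegenerate.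
exact: harmonic_cone_over.
Qed.

End minimal_cones.

Theorem corollary7p1 (R : realType) (p q : nat) (B : 'M[R]_(p + q))
    (hB : has_signature B) :
  quadric_is_homogeneous B /\
  exists restrict : set 'rV[R]_(p + q) -> set 'rV[R]_(p + q),
    set_bij (minimal_cones B) (minimal_submanifolds_of_quadric B) restrict /\
    forall (X : set 'rV[R]_(p + q)) (m : nat) (Sigma : set 'rV[R]_m)
      (i : 'rV[R]_m * R^o -> 'rV[R]_(p + q)),
      minimal_cones B X -> cone_presentation B X Sigma i ->
      restrict X = [set i (x, 1) | x in Sigma].
Proof.
have sB := signature_sym hB; have uB := signature_unit hB.
split; first exact: homogeneous_quadric.
exists (fun X => X `&` quadric B); split; last first.
  by move=> X m Sigma i _; exact: presentation_restrict.
split.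
- by move=> X /(restrict_minimal_cone sB uB)[].
- move=> X Y /set_mem/(restrict_minimal_cone sB uB)[_ XE].
  by move=> /set_mem/(restrict_minimal_cone sB uB)[_ YE] E; rewrite XE YE E.
- move=> S hS; exists (cone_over S); first exact: minimal_cone_over.
  by case: hS => _ [_ SQ _ _]; exact: cone_over_quadric.
Qed.
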